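(* Let $X$ be a compact metric space, $Y\subset[-1,1]$ compact, $Z:=X\times Y$, and let $H$ be the RKHS of a continuous kernel over $X$ with closed unit ball $B_H$ and with $\|f\|_\infty\le\|f\|_H$ for all $f\in H$. Assume there are constants $a\ge 1$ and $0<p<2$ such that for all $n\ge1$ and all $\delta>0$, $$\sup_{T\in Z^n}\log\mathcal N(B_H,\delta,L_2(T_X))\le a\,\delta^{-p}.$$ Let $L:Y\times\mathbb R\to[0,\infty)$ be continuous, convex in its second variable, and satisfy, for some constants $\alpha\in[1,2]$ and $c_L>0$ and all $t\ge 0$, $$\sup_{y\in Y}L(y,t)\le 1+|t|^\alpha\quad(\text{for all }t\in\mathbb R),\qquad \sup_{y\in Y}\big|L(y,\cdot)|_{[-t,t]}\big|_1\le c_L\,t^{\alpha-1},$$ where $|h|_1$ denotes the Lipschitz constant of $h$. Let $P$ be a Borel probability measure on $X\times Y$ such that a minimizer $f^*_{L,P}$ of the $L$-risk over all measurable functions exists. Suppose that for all $0<\lambda\le1$ and all $f\in\lambda^{-1/2}B_H$, $$\mathbb E_P\big(L\circ f-L\circ f^*_{L,P}\big)^2\le c\,(\|f\|_\infty+1)^v\Big(\mathbb E_P\big(L\circ f-L\circ f^*_{L,P}\big)\Big)^{\vartheta}$$ for some constants $c\ge1$, $\vartheta\in(0,1]$, $v\in[0,2]$. Then there exists a constant $K\ge1$ such that for all $n\ge 1$, $0<\lambda\le1$, $\varepsilon>0$, $x\ge1$ satisfying $$\varepsilon\ge\max\Big\{a(\lambda)+\lambda,\ \Big(\tfrac{Ka}{\lambda^{\frac{2\alpha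 p+v(2-p)}{4}}n}\Big)^{\frac{4}{8-2\alpha p-(v+2\vartheta)(2-p)}},\ \Big(\tfrac{Ka}{\lambda^{\frac{\alpha(2+p)}{4}}n}\Big)^{\frac{4}{(2+p)(2-\alpha)}},\ \Big(\tfrac{Kx}{\lambda^{\frac{v}{2}}n}\Big)^{\frac{2}{4-v-2\vartheta}},\ \Big(\tfrac{Kx}{\lambda^{\frac{\alpha}{2}}n}\Big)^{\frac{2}{2-\alpha}}\Big\}$$ we have $$\Pr{}^*\big(T\in Z^n:\ \mathcal R_{L,P}(f_{T,\lambda})-\mathcal R^*_{L,P}<a(\lambda)+\varepsilon\big)\ge1-e^{-x},$$ where $\Pr^*$ denotes outer probability with respect to $P^n$.
   Context: For a measurable $f:X\to\mathbb R$, $L\circ f$ denotes the function $(x,y)\mapsto L(y,f(x))$, $\mathcal R_{L,P}(f):=\mathbb E_{(x,y)\sim P}L(y,f(x))$, and $\mathcal R^*_{L,P}:=\inf\{\mathcal R_{L,P}(f): f:X\to\mathbb R\text{ measurable}\}$; $f^*_{L,P}$ is a measurable function attaining this infimum. For $\lambda>0$, $f_{P,\lambda}:=\arg\min_{f\in H}(\lambda\|f\|_H^2+\mathcal R_{L,P}(f))$, and for a sample $T=((x_1,y_1),\dots,(x_n,y_n))\in Z^n$, $f_{T,\lambda}$ denotes the same minimizer with $P$ replaced by the empirical measure of $T$. The approximation error function is $a(\lambda):=\lambda\|f_{P,\lambda}\|_H^2+\mathcal R_{L,P}(f_{P,\lambda})-\mathcal R^*_{L,P}$ (not to be confused with the constant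 $a$). For $T_X=(x_1,\dots,x_n)$, $L_2(T_X)$ is the space of (classes of) functions on $X$ with norm $\|f\|_{L_2(T_X)}=(\frac1n\sum_i f(x_i)^2)^{1/2}$. For a subset $A$ of a Banach space $E$ with closed unit ball $B_E$, $\mathcal N(A,\varepsilon,E):=\min\{m\ge1:\exists x_1,\dots,x_m\in E,\ A\subset\bigcup_i(x_i+\varepsilon B_E)\}$. Conventions: $0^0:=1$, and when an exponent equals $+\infty$ (e.g. $\frac{2}{2-\alpha}$ with $\alpha=2$), $s^\infty:=0$ for $0\le s<1$, $:=1$ for $s=1$, $:=\infty$ for $s>1$. *)

(* Defs.v *)
From HB Require Import structures.
From mathcomp Require Import all_boot all_order all_algebra.
From mathcomp Require Import all_classical all_reals all_analysis.
Set Implicit Arguments.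
Unset Strict Implicit.
Unset Printing Implicit Defensive.
Import Order.TTheory GRing.Theory Num.Theory.
Import numFieldNormedType.Exports.
Local Open Scope classical_set_scope.
Local Open Scope ring_scope.

Definition borelType (X : pointedType) (opn : set (set X)) := g_sigma_algebraType opn.

Section RKHS.
Context {R : realType} {X : Type}.

Definition Hnorm (ip : (X -> R) -> (X -> R) -> R) (f : X -> R) : R :=
  Num.sqrt (ip f f).

Definition is_RKHS (H : set (X -> R)) (ip : (X -> R) -> (X -> R) -> R)
    (k : X -> X -> R) : Prop :=
  [/\
      H (fun _ => 0) /\
      (forall (a : R) f g, H f -> H g -> H (fun x => a * f x + g x)),
      (forall (a : R) f g h, H f -> H g -> H h ->
         ip (fun x => a * f x + g x) h = a * ip f h + ip g h) /\
      (forall f g, H f -> H g -> ip f g = ip g f) /\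
      (forall f, H f -> 0 <= ip f f) /\
      (forall f, H f -> ip f f = 0 -> f = (fun _ => 0)),
      (forall u : nat -> (X -> R), (forall m, H (u m)) ->
        (forall e : R, 0 < e -> exists N, forall m m', (N <= m)%N -> (N <= m')%N ->
            Hnorm ip (fun x => u m x - u m' x) < e) ->
        exists2 f, H f & forall e : R, 0 < e -> exists N, forall m, (N <= m)%N ->
            Hnorm ip (fun x => u m x - f x) < e),
      (forall x, H (fun y => k y x)) &
      (forall f x, H f -> f x = ip f (fun y => k y x))].

Definition supnorm (f : X -> R) : R := sup [set `|f x| | x in [set: X]].

Definition L2emp_norm (n : nat) (TX : 'I_n -> X) (g : X -> R) : R :=
  Num.sqrt ((n%:R)^-1 * \sum_(i < n) (g (TX i)) ^+ 2).

(* covering number N(B_H, delta, L_2(T_X)) (as an extended real; +oo if no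
   finite cover exists) *)
Definition covnum_BH (H : set (X -> R)) (ip : (X -> R) -> (X -> R) -> R)
    (delta : R) (n : nat) (TX : 'I_n -> X) : \bar R :=
  ereal_inf [set (m%:R)%:E | m in [set m : nat | (1 <= m)%N /\
    exists c : 'I_m -> (X -> R), forall f, H f -> Hnorm ip f <= 1 ->
      exists j : 'I_m, L2emp_norm TX (fun x => f x - c j x) <= delta]].

End RKHS.

Section Risks.
Local Open Scope ereal_scope.
Context {R : realType} {X : pointedType} {opn : set (set X)}.
Notation Z := (borelType opn * R)%type.

Definition risk (P : probability Z R) (L : R -> R -> R) (f : X -> R) : \bar R :=
  \int[P]_z (L z.2 (f z.1))%:E.

Definition bayes_risk (P : probability Z R) (L : R -> R -> R) : \bar R :=
  ereal_inf [set risk P L f | f in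
    [set f : X -> R | measurable_fun [set: borelType opn] (f : borelType opn -> R)]].

Definition emp_risk (L : R -> R -> R) (n : nat) (T : 'I_n -> X * R) (f : X -> R)
  : \bar R :=
  ((n%:R)^-1 * \sum_(i < n) L (T i).2 (f (T i).1))%:E.

Definition is_reg_min (H : set (X -> R)) (ip : (X -> R) -> (X -> R) -> R)
    (lambda : R) (Risk : (X -> R) -> \bar R) (f : X -> R) : Prop :=
  H f /\ forall g, H g ->
    (lambda * Hnorm ip f ^+ 2)%:E + Risk f <= (lambda * Hnorm ip g ^+ 2)%:E + Risk g.

(* outer probability w.r.t. P^n: the outer measure generated by measurable
   rectangles A_1 x ... x A_n (Caratheodory construction of P^n) *)
Definition outer_prob_n (P : probability Z R) (n : nat) (A : set ('I_n -> X * R))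
  : \bar R :=
  ereal_inf [set \sum_(k <oo) \prod_(i < n) P (C k i) | C in
    [set C : nat -> 'I_n -> set Z | (forall k i, measurable (C k i)) /\
       A `<=` \bigcup_k [set T | forall i, C k i (T i)]]].

End Risks.

(* s^(num/den) for den >= 0, with the paper's convention s^(+oo) when den = 0:
   0 if 0 <= s < 1, 1 if s = 1, +oo if s > 1 *)
Definition pow_ext {R : realType} (s num den : R) : \bar R :=
  if den == 0 then (if s < 1 then 0%E else if s == 1 then 1%E else +oo%E)
  else (s `^ (num / den))%:E.

(* Main.v *)
(* Convexity of the regularized empirical risk along the segment from [f_{P,lambda}]
   to [f_{T,lambda}] and continuity of the regularized true risk show that, if the
   conclusion fails for [T], then some [f] in [H] whose regularized excess risk over
   [f_{P,lambda}] is exactly [eps] has empirical mean of [L o f - L o f_{P,lambda}] smaller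
   by [eps] than its true mean.  Such [f] satisfy [lambda * ||f||^2 <= 2 eps], whence, with
   [b = eps / lambda >= 1], range [O(b^(alpha/2))], variance [O(b^(v/2) eps^theta)] and
   empirical entropy [O(a (b^(alpha/2) / delta)^p)] of these loss differences.

   The class is totally bounded in sup norm, and quantizing the finitely many functions of a
   net replaces [P] by a probability on a finite set of cells; products of cells are
   measurable rectangles, so outer probabilities reduce to finite sums.  On the finite
   space the deviation is bounded without Talagrand's inequality: a ghost sample and random
   signs, Hoeffding's inequality, Le Cam's square root trick to control the empirical second
   moments, and chaining with geometrically decreasing thresholds.  The radius
   [rho ~ max (b^(v/2) eps^theta) (b^(alpha/2) eps)] turns the resulting conditions into the
   four lower bounds on [eps]. *)
Require Import Defs.
From HB Require Import structures.
From mathcomp Require Import all_boot all_order all_algebra finmap.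
From mathcomp Require Import all_classical all_reals all_analysis.
From mathcomp Require Import measurable_realfun ring lra.
Set Implicit Arguments.
Unset Strict Implicit.
Unset Printing Implicit Defensive.
Import Order.TTheory GRing.Theory Num.Theory.
Import numFieldNormedType.Exports.
Local Open Scope classical_set_scope.
Local Open Scope ring_scope.

(** * Symmetrization on finite product spaces *)

(** No measurability of [T |-> fT T] is assumed, so the good event can only be bounded from below by
    products of cells found inside it. Failure must therefore be detected by finitely many
    functions; this is the purpose of the sup-norm net, whose members have to obey the localization
    constraints themselves. Excess exactly [eps], rather than at least [eps], keeps norms and
    variances under control. The variance hypothesis is applied at the parameter [1 / (2 b)], whose
    ball contains the localized functions, and not at [lambda]; [lambda <= eps] makes it admissible.
    Chaining conditionally on a sample needs empirical diameters, whereas only true variances are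
    given: hence the second-moment step. Radii are squared throughout, so the entropy exponent is
    [h = p / 2]. Dividing the squared radius by 4 multiplies the entropy by [4^h], while Hoeffding's
    exponent is multiplied by [4 r^2] if thresholds shrink by [r]; [p < 2] leaves room for some
    [r < 1]. *)

Section ExpBounds.
Variable R : realType.
Implicit Types u : R.

(** Follows from [exp u <= 1 / (1 - u)], since [(1 + u + 2 u^2) (1 - u) = 1 + u^2 (1 - 2 u)] is at
    least 1 for [u <= 1/2]. *)
Lemma expR_le_quadratic u : `|u| <= 1 / 2 -> expR u <= 1 + u + 2 * u ^+ 2.
Proof.
rewrite ler_norml => /andP[u1 u2].
have h : 1 - u <= expR (- u) by exact: expR_ge1Dx.
have h0 : 0 < 1 - u by lra.
have : expR u <= (1 - u)^-1.
  by rewrite -[u in expR u]opprK expRN lef_pV2 ?posrE ?expR_gt0.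
move=> /le_trans; apply.
rewrite -[leLHS]mul1r ler_pdivrMr//.
by have := sqr_ge0 u; nra.
Qed.

(** For small [u] the linear terms of the two quadratic bounds cancel; for [u > 1/2] already
    [u <= 2 u^2]. *)
Lemma cosh_le u : (expR u + expR (- u)) / 2 <= expR (2 * u ^+ 2).
Proof.
wlog u0 : u / 0 <= u.
  move=> H; have [/H//|u0] := leP 0 u.
  have := H (- u); rewrite opprK sqrrN addrC; apply; lra.
have [u1|u1] := leP u (1 / 2).
  have h1 : expR u <= 1 + u + 2 * u ^+ 2.
    by apply: expR_le_quadratic; rewrite ger0_norm.
  have h2 : expR (- u) <= 1 + (- u) + 2 * (- u) ^+ 2.
    by apply: expR_le_quadratic; rewrite normrN ger0_norm.
  rewrite sqrrN in h2; have := expR_ge1Dx (2 * u ^+ 2); lra.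
have h1 : expR (- u) <= expR u by rewrite ler_expR; lra.
have h2 : expR u <= expR (2 * u ^+ 2) by rewrite ler_expR expr2; nra.
lra.
Qed.

End ExpBounds.

Section ProductProbability.
Variables (R : realType) (S : finType) (q : S -> R).
Hypothesis q_ge0 : forall s, 0 <= q s.
Hypothesis q_sum1 : \sum_s q s = 1.
Variable n : nat.
Implicit Types (T : {ffun 'I_n -> S}) (A B : pred {ffun 'I_n -> S}).

(** One product measure serves both the quantized sample, with [q] the masses of the cells, and the
    random signs, with weights [coin]. *)
Definition prodw T : R := \prod_i q (T i).
Definition Pr A : R := \sum_(T | A T) prodw T.

Lemma prodw_ge0 T : 0 <= prodw T.
Proof. exact: prodr_ge0. Qed.

Lemma sum_prod (F : 'I_n -> S -> R) :
  \sum_(T : {ffun 'I_n -> S}) \prod_i F i (T i) = \prod_i \sum_s F i s.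
Proof. by rewrite bigA_distr_bigA. Qed.

Lemma sum_prodw : \sum_(T : {ffun 'I_n -> S}) prodw T = 1.
Proof. by rewrite (sum_prod (fun=> q)) big1. Qed.

Lemma Pr_ge0 A : 0 <= Pr A.
Proof. by apply: sumr_ge0 => T _; exact: prodw_ge0. Qed.

Lemma PrE A : Pr A = \sum_(T : {ffun 'I_n -> S}) prodw T * (A T)%:R.
Proof.
by rewrite /Pr big_mkcond; apply: eq_bigr => T _; case: (A T); rewrite ?mulr1 ?mulr0.
Qed.

Lemma Pr_le A B : (forall T, A T -> B T) -> Pr A <= Pr B.
Proof.
move=> AB; rewrite !PrE; apply: ler_sum => T _; rewrite ler_wpM2l ?prodw_ge0//.
by case: (A T) (AB T) => [->//|_]; rewrite ler_nat.
Qed.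

Lemma Pr_compl A : Pr (predC A) = 1 - Pr A.
Proof. by rewrite -sum_prodw (bigID A)/= /Pr addrAC subrr add0r. Qed.

Lemma Pr_orb A B : Pr (fun T => A T || B T) <= Pr A + Pr B.
Proof.
rewrite !PrE -big_split; apply: ler_sum => T _ /=; rewrite -mulrDr.
by rewrite ler_wpM2l ?prodw_ge0// -natrD ler_nat; case: (A T); case: (B T).
Qed.

Lemma Pr_exists (J : finType) (D : {pred J}) (A : J -> pred {ffun 'I_n -> S}) :
  Pr (fun T => [exists j in D, A j T]) <= \sum_(j in D) Pr (A j).
Proof.
under [leRHS]eq_bigr do rewrite PrE.
rewrite exchange_big PrE; apply: ler_sum => T _.
rewrite -mulr_sumr ler_wpM2l ?prodw_ge0//.
case: existsP => [[j /andP[jD Aj]]|_]; last by apply: sumr_ge0.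
by rewrite (bigD1 j)//= Aj lerDl sumr_ge0.
Qed.

(** Exponential Markov inequality; the free scale is absorbed in [X] and [t], so each caller
    multiplies both by its own parameter. *)
Lemma chernoff (X : 'I_n -> S -> R) (t : R) :
  Pr (fun T => t <= \sum_i X i (T i)) <=
  expR (- t) * \prod_i \sum_s q s * expR (X i s).
Proof.
rewrite -sum_prod mulr_sumr PrE; apply: ler_sum => T _.
rewrite big_split/= mulrCA ler_wpM2l ?prodw_ge0//.
rewrite -expR_sum -expRD; case: (leP t) => [h|_]; rewrite ?expR_ge0//.
by rewrite -[leLHS]/(1 : R) -expR0 ler_expR; lra.
Qed.

End ProductProbability.

Section Rademacher.
Variables (R : realType) (n : nat).

Definition coin (b : bool) : R := 2^-1.
Definition rsign (b : bool) : R := if b then -1 else 1.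

Lemma coin_ge0 b : 0 <= coin b.
Proof. by rewrite /coin; lra. Qed.

Lemma coin_sum1 : \sum_b coin b = 1.
Proof. by rewrite big_bool /coin /=; lra. Qed.

Lemma hoeffding (w : 'I_n -> R) (t W : R) : 0 < W -> 0 <= t ->
  \sum_i w i ^+ 2 <= W ->
  Pr coin (fun e : {ffun 'I_n -> bool} => t <= \sum_i rsign (e i) * w i) <=
  expR (- (t ^+ 2 / (8 * W))).
Proof.
(* [t / (4 W)] minimizes the exponent [2 s^2 W - s t] left by [cosh_le]; the minimum is
   [- t^2 / (8 W)]. *)
move=> W0 t0 wW; pose s := t / (4 * W).
have s0 : 0 <= s by rewrite divr_ge0 //; lra.
have := chernoff coin_ge0 (fun i b => s * (rsign b * w i)) (s * t).
move=> /(le_trans _) ch; apply: (le_trans (y := expR (- (s * t)) *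
  \prod_(i < n) \sum_b coin b * expR (s * (rsign b * w i)))).
  apply: ch; apply: Pr_le; first exact: coin_ge0.
  by move=> e he; rewrite -mulr_sumr ler_wpM2l.
apply: (le_trans (y := expR (- (s * t)) * \prod_(i < n) expR (2 * (s * w i) ^+ 2))).
  rewrite ler_wpM2l ?expR_ge0//; apply: ler_prod => i _; apply/andP; split.
    by apply: sumr_ge0 => b _; rewrite mulr_ge0 ?coin_ge0 ?expR_ge0.
  rewrite big_bool /coin /rsign /= (_ : s * (-1 * w i) = - (s * w i)); last by ring.
  rewrite mul1r -mulrDr addrC mulrC; exact: cosh_le.
rewrite -expR_sum -expRD ler_expR.
under eq_bigr do rewrite exprMn mulrA.
rewrite -mulr_sumr.
have -> : t ^+ 2 / (8 * W) = s * t - 2 * s ^+ 2 * W by rewrite /s; field; lra.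
have : 2 * s ^+ 2 * \sum_(i < n) w i ^+ 2 <= 2 * s ^+ 2 * W.
  by apply: ler_wpM2l => //; apply: mulr_ge0 => //; exact: sqr_ge0.
lra.
Qed.

End Rademacher.

Section Ghost.
Variables (R : realType) (S : finType) (q : S -> R).
Hypothesis q_ge0 : forall s, 0 <= q s.
Hypothesis q_sum1 : \sum_s q s = 1.
Variables (n : nat) (I : finType).
Implicit Types (T : {ffun 'I_n -> S}) (e : {ffun 'I_n -> bool}).

Definition mix e T T' : {ffun 'I_n -> S} := [ffun i => if e i then T' i else T i].

(** Exchanging the coordinates selected by [e] is an involution of pairs of samples that only
    permutes the factors of the weight. *)
Lemma sum_mix e (F : {ffun 'I_n -> S} -> {ffun 'I_n -> S} -> R) :
  \sum_(T : {ffun 'I_n -> S}) \sum_(T' : {ffun 'I_n -> S})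
    prodw q T * prodw q T' * F T T' =
  \sum_(T : {ffun 'I_n -> S}) \sum_(T' : {ffun 'I_n -> S})
    prodw q T * prodw q T' * F (mix e T T') (mix e T' T).
Proof.
rewrite !pair_bigA /=.
pose h (u : {ffun 'I_n -> S} * {ffun 'I_n -> S}) := (mix e u.1 u.2, mix e u.2 u.1).
have hK : involutive h.
  by move=> [T T']; congr pair; apply/ffunP => i; rewrite !ffunE; case: (e i).
rewrite (reindex h)/=; last by exists h => u _; exact: hK.
apply: eq_bigr => -[T T'] _ /=; congr (_ * _).
rewrite /prodw -!big_split; apply: eq_bigr => i _ /=; rewrite !ffunE.
by case: (e i); rewrite // mulrC.
Qed.

(* Symmetrization by a ghost sample: [T'] is an independent copy of [T] on which
   the event is unlikely; the law of the pair is invariant under exchanging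
   individual coordinates of [T] and [T']. *)
Lemma ghost (Bad Good : I -> pred {ffun 'I_n -> S}) (u : R) :
  (forall i, 2^-1 <= Pr q (Good i)) ->
  (forall T T', Pr (@coin R) (fun e => [exists i, Bad i (mix e T T') &&
     Good i (mix e T' T)]) <= u) ->
  Pr q (fun T => [exists i, Bad i T]) <= 2 * u.
Proof.
move=> hG hS.
pose F T T' : R := [exists i, Bad i T && Good i T']%:R.
(* The witness [i] depends on [T] alone, so the [T'] in [Good i] still carry mass at least one half;
   this is the factor 2. *)
have h1 : Pr q (fun T => [exists i, Bad i T]) <=
    2 * \sum_(T : {ffun 'I_n -> S}) \sum_(T' : {ffun 'I_n -> S})
    prodw q T * prodw q T' * F T T'.
  rewrite PrE mulr_sumr; apply: ler_sum => T _.
  have w0 := prodw_ge0 q_ge0 T.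
  under eq_bigr do rewrite -mulrA.
  rewrite -mulr_sumr mulrCA ler_wpM2l//.
  case: existsP => [[i Bi]|_]; last first.
    rewrite mulr_ge0// sumr_ge0// => T' _.
    by rewrite mulr_ge0 ?prodw_ge0// ler0n.
  have : 2^-1 <= \sum_(T' : {ffun 'I_n -> S}) prodw q T' * F T T'; last first.
    by rewrite -[X in _ -> X <= _]/(1 : R); lra.
  apply: (le_trans (hG i)); rewrite PrE; apply: ler_sum => T' _.
  rewrite ler_wpM2l ?prodw_ge0// ler_nat.
  case: (boolP (Good i T')) => // Gi.
  by rewrite (_ : [exists _, _]) //; apply/existsP; exists i; rewrite Bi.
apply: (le_trans h1); rewrite ler_pM2l//.
set V := (X in X <= u).
(* [V] is unchanged by mixing with any fixed [e], hence equals the average over random [e];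
   exchanging the sums then allows [hS] at fixed [T] and [T']. *)
have -> : V = \sum_(e : {ffun 'I_n -> bool}) prodw (@coin R) e *
    (\sum_(T : {ffun 'I_n -> S}) \sum_(T' : {ffun 'I_n -> S})
    prodw q T * prodw q T' * F (mix e T T') (mix e T' T)).
  under eq_bigr do rewrite -sum_mix.
  by rewrite -mulr_suml sum_prodw ?coin_sum1// mul1r.
under eq_bigr do rewrite mulr_sumr.
rewrite exchange_big/=.
under eq_bigr => T _.
  under eq_bigr do rewrite mulr_sumr.
  rewrite exchange_big/=; over.
apply: (le_trans (y := \sum_(T : {ffun 'I_n -> S}) \sum_(T' : {ffun 'I_n -> S})
    prodw q T * (prodw q T' * u))).
  apply: ler_sum => T _; apply: ler_sum => T' _.
  under eq_bigr do rewrite mulrCA.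
  rewrite -mulr_sumr -mulrA ler_wpM2l ?prodw_ge0// ler_wpM2l ?prodw_ge0//.
  by apply: (le_trans _ (hS T T')); rewrite PrE.
under eq_bigr do rewrite -mulr_sumr -mulr_suml sum_prodw// mul1r.
by rewrite -mulr_suml sum_prodw// mul1r.
Qed.

End Ghost.

(** * Chaining *)

(** One representative per code value turns a cover by outside centers into a net within [I]: [pi i]
    depends only on [code i], so [code] is injective on the image of [pi]. *)
Lemma net_of_code (I C : finType) (code : I -> C) :
  exists pi : I -> I, (#|pi @: [set: I]%SET| <= #|C|)%N /\
    forall i, code (pi i) = code i.
Proof.
pose pi i := odflt i [pick j | code j == code i].
have piE i : code (pi i) = code i.
  by rewrite /pi; case: pickP => [j /eqP|].
exists pi; split=> //.
rewrite -(@card_in_imset _ _ code); first exact: max_card.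
move=> _ _ /imsetP[i _ ->] /imsetP[j _ ->]; rewrite !piE => ij.
rewrite /pi ij; case: pickP => //= /(_ j).
by rewrite eqxx.
Qed.

Lemma powR_exprn (R : realType) (z e : R) (k : nat) : 0 <= z ->
  (z ^+ k) `^ e = (z `^ e) ^+ k.
Proof.
move=> z0; elim: k => [|k IH]; first by rewrite !expr0 powR1.
by rewrite !exprS powRM ?IH// exprn_ge0.
Qed.

Section Chaining.
Variables (R : realType) (I : finType) (n : nat) (w : I -> 'I_n -> R).
Variables (h A d0 th0 r y : R).
Hypothesis n_gt0 : (0 < n)%N.
Hypothesis d0_gt0 : 0 < d0.
Hypothesis th0_gt0 : 0 < th0.
Hypothesis A_ge0 : 0 <= A.
Hypothesis y_ge1 : 1 <= y.
Hypothesis h01 : 0 < h < 1.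
Hypothesis r01 : 0 < r < 1.
Hypothesis r_h : 4 `^ h <= 4 * r ^+ 2.
Hypothesis r_2 : 2 <= 4 * r ^+ 2.
Hypothesis w_diam : forall i, \sum_k w i k ^+ 2 <= n%:R * d0.
Hypothesis w_net : forall d, 0 < d -> exists pi : I -> I,
  (#|pi @: [set: I]%SET|%:R <= expR (A * d `^ (- h))) /\
  forall i, \sum_k (w i k - w (pi i) k) ^+ 2 <= n%:R * d.
Hypothesis size_cond : 32 * d0 * (8 * A * d0 `^ (- h) + y) <= n%:R * th0 ^+ 2.

Let d (k : nat) : R := d0 / 4 ^+ k.

Let d_gt0 k : 0 < d k.
Proof. by rewrite divr_gt0// exprn_gt0. Qed.

Let dS k : d k.+1 = d k / 4.
Proof. by rewrite /d exprS invfM mulrAC mulrA. Qed.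

Let d_powR k : d k `^ (- h) = d0 `^ (- h) * (4 `^ h) ^+ k.
Proof.
rewrite /d powRM ?invr_ge0 ?exprn_ge0//; last exact: ltW.
congr (_ * _); rewrite -powR_inv1 ?exprn_ge0// -powRrM mulrNN mul1r.
exact: powR_exprn.
Qed.

Let nR_gt0 : 0 < n%:R :> R.
Proof. by rewrite ltr0n. Qed.

Let bernoulli_pow (k : nat) : k.+1%:R <= (4 * r ^+ 2) ^+ k.
Proof.
apply: (@le_trans _ _ (2 ^+ k)); last first.
  apply: lerXn2r; rewrite ?nnegrE//. by have := sqr_ge0 r; lra.
by rewrite -natrX ler_nat ltn_expl.
Qed.

(** With [Q = (4 r^2)^k], two consecutive nets cost at most [8 A d0^(-h) Q] in entropy, as
    [4^h <= 4 r^2 <= 4], while Hoeffding's exponent is [n th0^2 / (32 d0) Q]. By [size_cond] the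
    surplus is at least [y Q >= y (k + 1)]. *)
Let level_exponent (k : nat) :
  2 * (A * d k.+1 `^ (- h)) - (n%:R * th0 * r ^+ k) ^+ 2 / (8 * (4 * n%:R * d k)) <=
  - (y * k.+1%:R).
Proof.
have [r0 r1] := andP r01.
set Q := (4 * r ^+ 2) ^+ k.
have Q0 : 0 <= Q by apply: exprn_ge0; have := sqr_ge0 r; lra.
have QE : Q = 4 ^+ k * (r ^+ k) ^+ 2 by rewrite /Q exprMn -!exprM mulnC.
have -> : (n%:R * th0 * r ^+ k) ^+ 2 / (8 * (4 * n%:R * d k)) =
    n%:R * th0 ^+ 2 / (32 * d0) * Q.
  have : 4 ^+ k != 0 :> R by rewrite gt_eqF// exprn_gt0.
  rewrite QE /d; move: (4 ^+ k) (r ^+ k) => F G F0; field.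
  by rewrite F0 !gt_eqF.
have s1 : 8 * A * d0 `^ (- h) + y <= n%:R * th0 ^+ 2 / (32 * d0).
  by rewrite ler_pdivlMr ?mulr_gt0// mulrC.
have s2 : A * d k.+1 `^ (- h) <= 4 * A * d0 `^ (- h) * Q.
  rewrite d_powR exprS (_ : 4 * A * d0 `^ (- h) * Q = A * (d0 `^ (- h) * (4 * Q))); last by ring.
  rewrite ler_wpM2l// ler_wpM2l ?powR_ge0// ler_pM ?powR_ge0 ?exprn_ge0 ?powR_ge0//.
    by apply: (le_trans r_h); rewrite ler_piMr// exprn_ile1// ltW.
  apply: lerXn2r; rewrite ?nnegrE ?powR_ge0//.
  by have := sqr_ge0 r; lra.
have s3 := ler_wpM2r Q0 s1.
have s4 : y * k.+1%:R <= y * Q.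
  by apply: ler_wpM2l; [exact: le_trans ler01 y_ge1|exact: bernoulli_pow].
by nra.
Qed.

Let sum_expR (m : nat) : \sum_(k < m) expR (- (y * k.+1%:R)) <= 2 * expR (- y).
Proof.
set z := expR (- y).
have z2 : z <= 1 / 2.
  rewrite /z expRN ler_pdivlMr// mulrC ler_pdivrMr ?expR_gt0// mul1r.
  by apply: le_trans (expR_ge1Dx _); have := y_ge1; lra.
have z0 : 0 <= z by exact: expR_ge0.
have E k : expR (- (y * k.+1%:R)) = z ^+ k.+1.
  by rewrite /z -expRM_natr mulNr.
under eq_bigr do rewrite E.
suff : \sum_(k < m) z ^+ k.+1 <= 2 * z - 2 * z ^+ m.+1.
  by have := exprn_ge0 m.+1 z0; lra.
elim: m => [|m IH]; first by rewrite big_ord0 expr1; lra.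
rewrite big_ord_recr/=; have := exprn_ge0 m.+1 z0.
by move: IH; rewrite (exprS z m.+1); move: (z ^+ m.+1) => u; nra.
Qed.

(** Each [w i] is reached from 0 through its net approximations. The thresholds [th0 r^k] on the
    increments sum to at most [th0 / (1 - r)]; the extra [th0] pays for a remainder bounded without
    randomness. *)
Lemma chaining : Pr (@coin R) (fun e : {ffun 'I_n -> bool} =>
    [exists i, n%:R * (th0 / (1 - r) + th0) <= \sum_k rsign R (e k) * w i k]) <=
  2 * expR (- y).
Proof.
have [[[r0 r1] d00] th00] := (andP r01, d0_gt0, th0_gt0).
have /choice[pi hpi] : forall k : nat, exists pi : I -> I,
    (#|pi @: [set: I]%SET|%:R <= expR (A * d k `^ (- h))) /\
    forall i, \sum_k (w i k - w (pi i) k) ^+ 2 <= n%:R * d k.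
  by move=> k; exact: w_net.
(* An increment depends on [i] only through its two consecutive net points, so the union bound runs
   over pairs. The chain starts at the zero vector, whose distance to [w i] is controlled by
   [w_diam]. *)
pose X (k : nat) (j : I * I) (l : 'I_n) : R :=
  w j.2 l - (if k is 0 then 0 else w j.1 l).
pose u (k : nat) i l : R := if k is 0 then 0 else w (pi k i) l.
have uX k i l : u k.+1 i l - u k i l = X k (pi k i, pi k.+1 i) l by case: k.
have u_dist k i : \sum_l (w i l - u k i l) ^+ 2 <= n%:R * d k.
  case: k => [|k]; last by have [_] := hpi k.+1; exact.
  by rewrite /u /d expr0 divr1; under eq_bigr do rewrite subr0.
pose t k := n%:R * th0 * r ^+ k.
pose lev k (e : {ffun 'I_n -> bool}) :=
  [exists i, t k <= \sum_l rsign R (e l) * (u k.+1 i l - u k i l)].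
have levP k : Pr (@coin R) (lev k) <= expR (- (y * k.+1%:R)).
  pose J := [set (pi k i, pi k.+1 i) | i in [set: I]]%SET.
  apply: (@le_trans _ _ (\sum_(j in J) expR (- (t k ^+ 2 / (8 * (4 * n%:R * d k)))))).
    apply: (@le_trans _ _ (Pr (@coin R) (fun e => [exists j in J,
        t k <= \sum_l rsign R (e l) * X k j l]))).
      apply: Pr_le; first exact: coin_ge0.
      move=> e /existsP[i hi]; apply/existsP; exists (pi k i, pi k.+1 i).
      rewrite imset_f//=; under eq_bigr do rewrite -uX; exact: hi.
    apply: le_trans (Pr_exists (@coin_ge0 R) _ _) _.
    apply: ler_sum => _ /imsetP[i _ ->]; apply: hoeffding.
    - by rewrite !mulr_gt0.
    - by rewrite !mulr_ge0 ?exprn_ge0// ltW.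
    - under eq_bigr do rewrite -uX.
      (* Passing through [w i] bounds the squared increment by [n (2 d k / 4 + 2 d k)], below the
         variance proxy [4 n d k]. *)
      apply: (@le_trans _ _ (\sum_l (2 * (w i l - u k.+1 i l) ^+ 2 +
          2 * (w i l - u k i l) ^+ 2))).
        apply: ler_sum => l _.
        by move: (u k.+1 i l) (u k i l) (w i l) => a b c; have := sqr_ge0 (a + b - 2 * c); nra.
      rewrite big_split/= -!mulr_sumr.
      have := u_dist k.+1 i; have := u_dist k i; rewrite dS.
      have : 0 <= n%:R * d k by rewrite mulr_ge0// ltW.
      by lra.
  rewrite sumr_const -[leLHS]mulr_natl.
  apply: (@le_trans _ _ (expR (2 * (A * d k.+1 `^ (- h))) *
      expR (- (t k ^+ 2 / (8 * (4 * n%:R * d k)))))).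
    rewrite ler_wpM2r ?expR_ge0//.
    apply: (@le_trans _ _ ((#|pi k @: [set: I]%SET| * #|pi k.+1 @: [set: I]%SET|)%N%:R)).
      rewrite ler_nat -cardsX; apply: subset_leq_card.
      by apply/fintype.subsetP => _ /imsetP[i _ ->]; rewrite inE/= !imset_f.
    rewrite natrM [2 * _]mulr_natl mulr2n expRD ler_pM//; last by have [] := hpi k.+1.
    have [/le_trans + _] := hpi k; apply; rewrite ler_expR ler_wpM2l//.
    rewrite !d_powR ler_wpM2l ?powR_ge0// exprS ler_peMl ?exprn_ge0 ?powR_ge0//.
    have -> : (1 <= 4 `^ h) = (1 `^ h <= 4 `^ h) by rewrite powR1.
    have [h0 _] := andP h01.
    by apply: ge0_ler_powR; rewrite ?nnegrE; lra.
  by rewrite -expRD ler_expR; exact: level_exponent.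
(* At this depth the squared resolution is below [th0^2], so by [|z| <= z^2 / (2 th0) + th0 / 2] the
   remainder is at most [n th0] for every choice of signs. *)
have [m dm] : exists m : nat, d m <= th0 ^+ 2.
  have [m hm] : exists m : nat, d0 / th0 ^+ 2 < m%:R.
    by exists (Num.bound (d0 / th0 ^+ 2)); apply: archi_boundP; rewrite divr_ge0 ?sqr_ge0// ltW.
  exists m; rewrite /d ler_pdivrMr ?exprn_gt0//.
  move: hm; rewrite ltr_pdivrMr ?exprn_gt0// => /ltW/le_trans; apply.
  rewrite mulrC ler_wpM2l ?sqr_ge0// -natrX ler_nat.
  by apply: ltnW; apply: ltn_expl.
apply: le_trans (sum_expR m).
apply: (@le_trans _ _ (\sum_(k in 'I_m) Pr (@coin R) (lev k))); last first.
  by apply: ler_sum => k _; exact: levP.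
apply: le_trans (Pr_exists (@coin_ge0 R) _ _).
apply: Pr_le; first exact: coin_ge0.
move=> e /existsP[i hi]; apply: contraT; rewrite negb_exists => /forallP hn.
have {}hn (k : 'I_m) : \sum_l rsign R (e l) * (u k.+1 i l - u k i l) < t k.
  by rewrite ltNge; apply: contra (hn k) => H; apply/andP; split=> //; apply/existsP; exists i.
have tel (k : nat) : (k <= m)%N -> \sum_l rsign R (e l) * u k i l <=
    n%:R * th0 * (1 - r ^+ k) / (1 - r).
  elim: k => [_|k IH km].
    by rewrite /u expr0 subrr mulr0 mul0r big1// => l _; rewrite mulr0.
  have := hn (Ordinal km); have := IH (ltnW km); rewrite /t /=.
  under [in X in _ -> X -> _]eq_bigr do rewrite mulrBr.
  rewrite sumrB => H1 H2.
  have -> : n%:R * th0 * (1 - r ^+ k.+1) / (1 - r) =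
     n%:R * th0 * (1 - r ^+ k) / (1 - r) + n%:R * th0 * r ^+ k.
    by rewrite exprS; field; lra.
  by lra.
have rem : \sum_l rsign R (e l) * (w i l - u m i l) <= n%:R * th0.
  apply: (@le_trans _ _ (\sum_l ((w i l - u m i l) ^+ 2 / (2 * th0) + th0 / 2))).
    apply: ler_sum => l _; move: (w i l - u m i l) => z.
    have : rsign R (e l) * z <= `|z|.
      by rewrite /rsign; case: (e l); rewrite ?mul1r ?ler_norm// mulN1r -normrN ler_norm.
    move=> /le_trans; apply.
    rewrite -[z ^+ 2]real_normK ?num_real//.
    have : 0 <= (`|z| - th0) ^+ 2 / (2 * th0) by rewrite divr_ge0 ?sqr_ge0//; lra.
    suff -> : (`|z| - th0) ^+ 2 / (2 * th0) = `|z| ^+ 2 / (2 * th0) + th0 / 2 - `|z| by lra.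
    by field; lra.
  rewrite big_split/= -mulr_suml sumr_const card_ord -mulr_natl.
  have : (\sum_l (w i l - u m i l) ^+ 2) / (2 * th0) <= n%:R * th0 / 2; last by lra.
  rewrite ler_pdivrMr; last by lra.
  apply: (le_trans (u_dist m i)).
  have := ler_wpM2l (ltW nR_gt0) dm; lra.
have := tel m (leqnn m).
have rm : 0 < r ^+ m by rewrite exprn_gt0.
have : n%:R * th0 * (1 - r ^+ m) / (1 - r) < n%:R * th0 / (1 - r).
  rewrite ltr_pM2r ?invr_gt0; last by lra.
  by rewrite gtr_pMr ?mulr_gt0//; lra.
move: rem; under eq_bigr do rewrite mulrBr.
by rewrite sumrB; lra.
Qed.

End Chaining.

(** * Deviations of a finite empirical process *)

Section EmpiricalProcess.
Variables (R : realType) (S : finType) (q : S -> R).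
Hypothesis q_ge0 : forall s, 0 <= q s.
Hypothesis q_sum1 : \sum_s q s = 1.
Variable n : nat.
Implicit Types T : {ffun 'I_n -> S}.

Let nR_ge0 : 0 <= n%:R :> R.
Proof. exact: ler0n. Qed.

(** On [[0, 1/2]] one has [exp u <= 1 + 2 u], so the exponential moment of [phi / (2 M)] is at most
    [exp (tau / M)]; [4 tau <= rho] lets half of the exponent survive. *)
Lemma upper_tail_nonneg (phi : S -> R) (M tau rho : R) : 0 < M ->
  (forall s, 0 <= phi s <= M) -> \sum_s q s * phi s <= tau -> 4 * tau <= rho ->
  Pr q (fun T => n%:R * rho <= \sum_k phi (T k)) <= expR (- (n%:R * rho / (4 * M))).
Proof.
move=> M0 phiM Ephi tau4.
have := chernoff q_ge0 (fun (k : 'I_n) s => phi s / (2 * M)) (n%:R * rho / (2 * M)).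
move=> /(le_trans _) ch; apply: le_trans.
  apply: ch; apply: Pr_le => // T hT.
  by rewrite -mulr_suml ler_pM2r// invr_gt0; lra.
have h1 : \sum_s q s * expR (phi s / (2 * M)) <= expR (tau / M).
  apply: (@le_trans _ _ (\sum_s (q s + q s * phi s * M^-1))).
    apply: ler_sum => s _.
    rewrite (_ : q s + q s * phi s * M^-1 = q s * (1 + phi s * M^-1)); last by ring.
    rewrite ler_wpM2l//.
    have /andP[p0 pM] := phiM s.
    set u := phi s / (2 * M).
    have u0 : 0 <= u by rewrite divr_ge0//; lra.
    have u1 : u <= 1 / 2 by rewrite ler_pdivrMr; lra.
    have -> : phi s * M^-1 = 2 * u by rewrite /u; field; lra.
    have := @expR_le_quadratic R u; rewrite ger0_norm// => /(_ u1).
    by move=> /le_trans; apply; nra.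
  rewrite big_split/= q_sum1 -mulr_suml; apply: le_trans (expR_ge1Dx _).
  by rewrite lerD2l ler_wpM2r// invr_ge0 ltW.
apply: (@le_trans _ _ (expR (- (n%:R * rho / (2 * M))) * expR (tau / M) ^+ n)).
  rewrite ler_wpM2l ?expR_ge0// -[in leRHS](card_ord n) -prodr_const.
  apply: ler_prod => i _; rewrite h1 andbT.
  by apply: sumr_ge0 => s _; rewrite mulr_ge0 ?expR_ge0.
rewrite -expRM_natr -expRD ler_expR.
have -> : n%:R * rho / (2 * M) = n%:R * rho / (4 * M) + n%:R * rho / (4 * M).
  by field; lra.
have : tau / M * n%:R <= n%:R * rho / (4 * M); last by lra.
have -> : n%:R * rho / (4 * M) = rho / 4 / M * n%:R by field; lra.
apply: ler_wpM2r => //; apply: ler_wpM2r; first by rewrite invr_ge0 ltW.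
by lra.
Qed.

(** Serves only to show that a ghost sample behaves well with constant probability, hence the fixed
    bound 1/4, which comes from [exp (- 3)]. *)
Lemma bernstein_lower (phi : S -> R) (B tau t : R) : 0 < B -> 0 < tau -> 0 < t ->
  (forall s, `|phi s| <= B) -> \sum_s q s * phi s ^+ 2 <= tau ->
  24 * tau <= n%:R * t ^+ 2 -> 24 * B <= n%:R * t ->
  Pr q (fun T => n%:R * t <= \sum_k (\sum_s q s * phi s - phi (T k))) <= 4^-1.
Proof.
move=> B0 tau0 t0 phiB Ephi c1 c2.
set m := \sum_s q s * phi s.
(* [s0] is the smaller of the unconstrained optimum [t / (4 tau)] and [1 / (4 B)]; the latter keeps
   [|s0 (m - phi s)| <= 1/2], as [expR_le_quadratic] demands. *)
have [s0 [s00 s0B s0e]] : exists s0 : R, [/\ 0 <= s0, s0 * (4 * B) <= 1 &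
    3 <= n%:R * (s0 * t - 2 * s0 ^+ 2 * tau)].
  have [h|h] := leP (t / (4 * tau)) ((4 * B)^-1).
    exists (t / (4 * tau)); split.
    - by rewrite divr_ge0//; lra.
    - by rewrite -ler_pdivlMr ?div1r//; lra.
    - have -> : n%:R * (t / (4 * tau) * t - 2 * (t / (4 * tau)) ^+ 2 * tau) =
        n%:R * t ^+ 2 / (8 * tau) by field; lra.
      by rewrite ler_pdivlMr; lra.
  exists (4 * B)^-1; split.
  - by rewrite invr_ge0; lra.
  - by rewrite mulVf//; lra.
  - have h2 : tau <= t * B.
      move: h; rewrite ltr_pdivlMr; last by lra.
      rewrite mulrC ltr_pdivrMr; last by lra.
      by lra.
    have -> : n%:R * ((4 * B)^-1 * t - 2 * (4 * B)^-1 ^+ 2 * tau) =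
        n%:R * (2 * t * B - tau) / (8 * B ^+ 2) by field; lra.
    rewrite ler_pdivlMr; last by rewrite mulr_gt0// exprn_gt0.
    apply: (@le_trans _ _ (n%:R * (t * B))); last by rewrite ler_wpM2l//; lra.
    by rewrite expr2; nra.
have mB : `|m| <= B.
  apply: (le_trans (ler_norm_sum _ _ _)).
  rewrite -[B]mul1r -q_sum1 mulr_suml; apply: ler_sum => s _.
  by rewrite normrM ger0_norm// ler_wpM2l.
have := chernoff q_ge0 (fun (k : 'I_n) s => s0 * (m - phi s)) (s0 * (n%:R * t)).
move=> /(le_trans _) ch; apply: le_trans.
  apply: ch; apply: Pr_le => // T hT.
  by rewrite -mulr_sumr ler_wpM2l.
have h1 : \sum_s q s * expR (s0 * (m - phi s)) <= expR (2 * s0 ^+ 2 * tau).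
  apply: (@le_trans _ _ (\sum_s (q s + s0 * (q s * m - q s * phi s) +
      2 * s0 ^+ 2 * (q s * m ^+ 2 - 2 * m * (q s * phi s) + q s * phi s ^+ 2)))).
    apply: ler_sum => s _.
    apply: (@le_trans _ _ (q s * (1 + s0 * (m - phi s) + 2 * (s0 * (m - phi s)) ^+ 2))).
      rewrite ler_wpM2l// expR_le_quadratic// normrM ger0_norm//.
      have : `|m - phi s| <= 2 * B.
        by apply: le_trans (ler_normB _ _) _; have := phiB s; lra.
      by move=> /(ler_wpM2l s00); lra.
    by rewrite le_eqVlt; apply/orP; left; apply/eqP; ring.
  rewrite !big_split/= q_sum1 -!mulr_sumr !big_split/= !sumrN -!mulr_sumr -!mulr_suml q_sum1 -/m.
  have : 2 * s0 ^+ 2 * (1 * m ^+ 2 - 2 * m * m + \sum_i q i * phi i ^+ 2) <= 2 * s0 ^+ 2 * tau.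
    apply: ler_wpM2l; first by rewrite mulr_ge0// sqr_ge0.
    by have := sqr_ge0 m; lra.
  by have := expR_ge1Dx (2 * s0 ^+ 2 * tau); lra.
apply: (@le_trans _ _ (expR (- (s0 * (n%:R * t))) * expR (2 * s0 ^+ 2 * tau) ^+ n)).
  rewrite ler_wpM2l ?expR_ge0// -[in leRHS](card_ord n) -prodr_const.
  apply: ler_prod => i _; rewrite h1 andbT.
  by apply: sumr_ge0 => s _; rewrite mulr_ge0 ?expR_ge0.
rewrite -expRM_natr -expRD.
apply: (@le_trans _ _ (expR (- 3))); first by rewrite ler_expR; lra.
rewrite expRN lef_pV2 ?posrE ?expR_gt0//.
by apply: le_trans (expR_ge1Dx _); lra.
Qed.

Variables (I : finType) (g : I -> S -> R) (A h B tau rho y : R).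
Hypothesis n_gt0 : (0 < n)%N.
Hypothesis A_ge0 : 0 <= A.
Hypothesis B_gt0 : 0 < B.
Hypothesis tau_gt0 : 0 < tau.
Hypothesis tau_rho : 4 * tau <= rho.
Hypothesis y_ge3 : 3 <= y.
Hypothesis h01 : 0 < h < 1.
Hypothesis g_bound : forall i s, `|g i s| <= B.
Hypothesis g_var : forall i, \sum_s q s * g i s ^+ 2 <= tau.
Hypothesis entropy : forall T d, 0 < d -> exists (N : nat) (code : I -> 'I_N),
  N%:R <= expR (A * d `^ (- h)) /\
  forall i j, code i = code j -> \sum_k (g i (T k) - g j (T k)) ^+ 2 <= n%:R * d.

Let nR_gt0 : 0 < n%:R :> R.
Proof. by rewrite ltr0n. Qed.

(** Mixing may send a coordinate to either half, so one net must serve both samples; pairing the two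
    codes doubles the entropy. *)
Let net2 T T' d : 0 < d -> exists pi : I -> I,
  #|pi @: [set: I]%SET|%:R <= expR (2 * (A * d `^ (- h))) /\
  forall i, \sum_k (g i (T k) - g (pi i) (T k)) ^+ 2 <= n%:R * d /\
            \sum_k (g i (T' k) - g (pi i) (T' k)) ^+ 2 <= n%:R * d.
Proof.
move=> d0; have [N [code [hN hc]]] := entropy T d0.
have [N' [code' [hN' hc']]] := entropy T' d0.
have [pi [hpi hpc]] := net_of_code (fun i => (code i, code' i)).
exists pi; split.
  apply: (@le_trans _ _ (N%:R * N'%:R)).
    by rewrite -natrM ler_nat (leq_trans hpi)// card_prod !card_ord.
  by rewrite [2 * _]mulr_natl mulr2n expRD ler_pM.
by move=> i; have [e1 e2] := hpc i; split; [apply: hc|apply: hc'].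
Qed.

Let sq i T : R := \sum_k g i (T k) ^+ 2.

Let sq_ge0 i T : 0 <= sq i T.
Proof. by apply: sumr_ge0 => k _; exact: sqr_ge0. Qed.

Let mix_sum (phi : S -> R) e T T' :
  \sum_k phi (mix e T T' k) + \sum_k phi (mix e T' T k) =
  \sum_k phi (T k) + \sum_k phi (T' k).
Proof.
rewrite -!big_split; apply: eq_bigr => k _ /=; rewrite !ffunE.
by case: (e k); rewrite // addrC.
Qed.

(** For fixed [T] and [T'] the imbalance of the mixed halves is a signed sum with fixed
    coefficients, ready for [hoeffding] and [chaining], while by [mix_sum] their total does not
    depend on [e]. *)
Let mix_diff (phi : S -> R) e T T' :
  \sum_k phi (mix e T T' k) - \sum_k phi (mix e T' T k) =
  \sum_k rsign R (e k) * (phi (T k) - phi (T' k)).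
Proof.
rewrite -sumrB; apply: eq_bigr => k _ /=; rewrite !ffunE /rsign.
by case: (e k); rewrite ?mul1r// mulN1r opprB.
Qed.

Hypothesis size_sq : 2 * B ^+ 2 * (2 * (A * rho `^ (- h)) + y) <= n%:R * rho.

Let rho_gt0 : 0 < rho.
Proof. by have := tau_rho; have := tau_gt0; lra. Qed.

Let sq_unlikely : expR (- (n%:R * rho / (4 * B ^+ 2))) <= 2^-1.
Proof.
apply: (@le_trans _ _ (expR (- 1))).
  rewrite ler_expR lerN2 ler_pdivlMr ?mulr_gt0 ?exprn_gt0//.
  have := size_sq; have := y_ge3; have := B_gt0.
  have : 0 <= A * rho `^ (- h) by rewrite mulr_ge0 ?powR_ge0.
  have : 0 < B ^+ 2 by rewrite exprn_gt0.
  by move: (A * _) (B ^+ 2) => u v; nra.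
rewrite expRN lef_pV2 ?posrE ?expR_gt0//.
by apply: le_trans (expR_ge1Dx _); lra.
Qed.

(* Le Cam's square root trick: with a ghost sample the event forces an imbalance
   of squared norms between the two halves of a fixed sample, which
   Hoeffding's inequality rules out at a finite net. *)
Lemma uniform_second_moment :
  Pr q (fun T => [exists i, n%:R * (64 * rho) < sq i T]) <= 2 * expR (- y).
Proof.
apply: (ghost q_ge0 q_sum1 (Bad := fun i T => n%:R * (64 * rho) < sq i T)
  (Good := fun i T => sq i T <= n%:R * rho)).
  move=> i; set G := fun T => _.
  have : Pr q (predC G) <= 2^-1; last by rewrite Pr_compl//; lra.
  apply: le_trans sq_unlikely.
  apply: le_trans (upper_tail_nonneg (phi := fun s => g i s ^+ 2) _ _ (g_var i) tau_rho).
  - by apply: Pr_le => // T; rewrite /G /= -ltNge => /ltW.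
  - by rewrite exprn_gt0.
  - move=> s; rewrite sqr_ge0/= -real_normK ?num_real//.
    by apply: lerXn2r; rewrite ?nnegrE ?(ltW B_gt0).
move=> T T'.
have [pi [hpi hd]] := net2 T T' rho_gt0.
pose V j := sq j T + sq j T'.
pose J := (pi @: [set: I])%SET.
(* The net errors of the two halves add up to at most [2 n rho]. In units of [n rho], the bad half
   of the net point is thus at least [(64 - 4) / 2 = 30] and the good half at most [2 + 4 = 6],
   which makes the imbalance at least half of the total [V j]. *)
pose ev j (e : {ffun 'I_n -> bool}) := (30 * (n%:R * rho) <= V j) &&
  (V j / 2 <= \sum_k rsign R (e k) * (g j (T k) ^+ 2 - g j (T' k) ^+ 2)).
apply: (@le_trans _ _ (Pr (@coin R) (fun e => [exists j in J, ev j e]))).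
  apply: Pr_le; first exact: coin_ge0.
  move=> e /existsP[i /andP[bad good]]; apply/existsP; exists (pi i).
  rewrite /J imset_f//=.
  have [d1 d2] := hd i.
  have dd := mix_sum (fun s => (g i s - g (pi i) s) ^+ 2) e T T'.
  have b1 : sq i (mix e T T') <= 2 * sq (pi i) (mix e T T') +
      2 * \sum_k (g i (mix e T T' k) - g (pi i) (mix e T T' k)) ^+ 2.
    rewrite /sq !mulr_sumr -big_split; apply: ler_sum => k _ /=.
    move: (g i (mix e T T' k)) (g (pi i) (mix e T T' k)) => a b.
    by have := sqr_ge0 (a - 2 * b); nra.
  have b2 : sq (pi i) (mix e T' T) <= 2 * sq i (mix e T' T) +
      2 * \sum_k (g i (mix e T' T k) - g (pi i) (mix e T' T k)) ^+ 2.
    rewrite /sq !mulr_sumr -big_split; apply: ler_sum => k _ /=.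
    move: (g i (mix e T' T k)) (g (pi i) (mix e T' T k)) => a b.
    by have := sqr_ge0 (2 * a - b); nra.
  have e1 : 0 <= \sum_k (g i (mix e T T' k) - g (pi i) (mix e T T' k)) ^+ 2.
    by apply: sumr_ge0 => k _; exact: sqr_ge0.
  have e2 : 0 <= \sum_k (g i (mix e T' T k) - g (pi i) (mix e T' T k)) ^+ 2.
    by apply: sumr_ge0 => k _; exact: sqr_ge0.
  have hV : V (pi i) = sq (pi i) (mix e T T') + sq (pi i) (mix e T' T).
    by rewrite /V /sq (mix_sum (fun s => g (pi i) s ^+ 2)).
  have hD := mix_diff (fun s => g (pi i) s ^+ 2) e T T'.
  rewrite /ev -hD hV -/(sq (pi i) (mix e T T')) -/(sq (pi i) (mix e T' T)).
  have := sq_ge0 (pi i) (mix e T' T).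
  move: dd b1 b2 e1 e2 bad good d1 d2; rewrite /=.
  move: (sq (pi i) _) (sq (pi i) _) (sq i _) (sq i _) => a a' b b'.
  move: (\sum_k (_ - _) ^+ 2) (\sum_k (_ - _) ^+ 2) (\sum_k (_ - _) ^+ 2) (\sum_k (_ - _) ^+ 2).
  move=> z1 z2 z3 z4; move: (n%:R * rho) (n%:R * (64 * rho)) (mulrCA (n%:R : R) 64 rho).
  by move=> N N64 -> *; apply/andP; split; lra.
apply: le_trans (Pr_exists (@coin_ge0 R) _ _) _.
apply: (@le_trans _ _ (\sum_(j in J) expR (- (n%:R * rho / (2 * B ^+ 2))))).
  apply: ler_sum => j _; rewrite /ev.
  have [hV|hV] /= := leP (30 * (n%:R * rho)) (V j); last first.
    by rewrite /Pr big_pred0_eq expR_ge0.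
  have nr0 : 0 < n%:R * rho by rewrite mulr_gt0.
  have V0 : 0 < V j by lra.
  have B2 : 0 < B ^+ 2 by rewrite exprn_gt0.
  (* Both squares lie in [[0, B^2]], so [B^2 V j] dominates the squared coefficients. The exponent
     is [V j / (32 B^2)], and 30/32 exceeds the 1/2 that is required. *)
  apply: le_trans (hoeffding (W := B ^+ 2 * V j) _ _ _) _.
  - by rewrite mulr_gt0.
  - by lra.
  - rewrite /V /sq -big_split mulr_sumr; apply: ler_sum => k _ /=.
    have gB s : g j s ^+ 2 <= B ^+ 2.
      rewrite -real_normK ?num_real//.
      by apply: lerXn2r; rewrite ?nnegrE ?(ltW B_gt0).
    move: (gB (T k)) (gB (T' k)) (sqr_ge0 (g j (T k))) (sqr_ge0 (g j (T' k))).
    by move: (g j (T k) ^+ 2) (g j (T' k) ^+ 2) => a b; nra.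
  - rewrite ler_expR lerN2.
    have -> : (V j / 2) ^+ 2 / (8 * (B ^+ 2 * V j)) = V j / 16 / (2 * B ^+ 2).
      by field; rewrite !gt_eqF.
    by rewrite ler_pM2r ?invr_gt0 ?mulr_gt0//; lra.
rewrite sumr_const -[leLHS]mulr_natl.
apply: (@le_trans _ _ (expR (2 * (A * rho `^ (- h))) * expR (- (n%:R * rho / (2 * B ^+ 2))))).
  by rewrite ler_wpM2r ?expR_ge0.
rewrite -expRD ler_expR.
have : 2 * (A * rho `^ (- h)) + y <= n%:R * rho / (2 * B ^+ 2); last by lra.
rewrite ler_pdivlMr ?mulr_gt0 ?exprn_gt0//.
by rewrite mulrC; exact: size_sq.
Qed.

Variables (eps r : R).
Hypothesis eps_gt0 : 0 < eps.
Hypothesis r01 : 0 < r < 1.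
Hypothesis r_h : 4 `^ h <= 4 * r ^+ 2.
Hypothesis r_2 : 2 <= 4 * r ^+ 2.
Hypothesis size_var : 24 * tau <= n%:R * (eps / 2) ^+ 2.
Hypothesis size_bound : 24 * B <= n%:R * (eps / 2).
Hypothesis size_chain :
  32 * (256 * rho) * (64 * A * (256 * rho) `^ (- h) + y) <=
  n%:R * (eps * (1 - r) / 4) ^+ 2.

Let mean i := \sum_s q s * g i s.

Let small T := [forall i, sq i T <= n%:R * (64 * rho)].

(** The bad and good events together force a signed sum of [g i (T' k) - g i (T k)] above
    [n eps / 2], which [chaining] with [th0 = eps (1 - r) / 4] makes improbable. *)
Let chained T T' :
  Pr (@coin R) (fun e => [exists i,
     (n%:R * eps <= \sum_k (mean i - g i (mix e T T' k))) && small (mix e T T') &&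
     ((\sum_k (mean i - g i (mix e T' T k)) < n%:R * (eps / 2)) && small (mix e T' T))])
  <= 2 * expR (- y).
Proof.
have [[r0 r1] [e0 rh0]] := (andP r01, (eps_gt0, rho_gt0)).
(* Total second moments are invariant under mixing. If one exceeds [128 n rho], the mixed samples
   cannot both be [small] and the event is empty; otherwise each [w i] has squared norm at most
   [256 n rho]. *)
have [diam|ndiam] := boolP [forall i, sq i T + sq i T' <= n%:R * (128 * rho)]; last first.
  rewrite /Pr big_pred0 ?mulr_ge0 ?expR_ge0//.
  move=> e; apply/existsP => -[i /andP[/andP[_ /forallP s1] /andP[_ /forallP s2]]].
  move/negP: ndiam; apply; apply/forallP => j.
  rewrite /sq -(mix_sum (fun s => g j s ^+ 2) e).
  by have := s1 j; have := s2 j; rewrite /sq; lra.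
pose w i k := g i (T' k) - g i (T k).
apply: le_trans (@chaining R I n w h (8 * A) (256 * rho) (eps * (1 - r) / 4) r y
  _ _ _ _ _ _ _ _ _ _ _ _) => //.
- apply: Pr_le; first exact: coin_ge0.
  move=> e /existsP[i /andP[/andP[bad _] /andP[good _]]]; apply/existsP; exists i.
  have hD := mix_diff (g i) e T' T.
  rewrite /w -hD.
  move: bad good; rewrite !sumrB.
  have : n%:R * (eps * (1 - r) / 4 / (1 - r) + eps * (1 - r) / 4) <= n%:R * (eps / 2).
    rewrite ler_wpM2l//.
    have -> : eps * (1 - r) / 4 / (1 - r) = eps / 4 by field; lra.
    by nra.
  by lra.
- by apply: mulr_gt0; rewrite ?ltr0n.
- by rewrite divr_gt0// mulr_gt0//; lra.
- by rewrite mulr_ge0.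
- by have := y_ge3; lra.
- move=> i; have /forallP/(_ i) := diam.
  have : \sum_k w i k ^+ 2 <= 2 * (sq i T + sq i T'); last by lra.
  rewrite mulrDr /sq !mulr_sumr -big_split; apply: ler_sum => k _ /=.
  by rewrite /w; move: (g i _) (g i _) => a b; have := sqr_ge0 (a + b); nra.
(* Squared errors of a difference are at most twice the sum over both samples, hence nets of squared
   radius [d / 4]; [4^h <= 4] turns the entropy factor 2 into 8. *)
- move=> d d0.
  have d4 : 0 < d / 4 by rewrite divr_gt0.
  have [pi [hpi hd]] := net2 T T' d4.
  exists pi; split.
    apply: (le_trans hpi); rewrite ler_expR.
    have -> : 8 * A * d `^ (- h) = 2 * (A * (4 * d `^ (- h))) by ring.
    rewrite ler_pM2l// ler_wpM2l// powRM ?invr_ge0// ?(ltW d0)// [leRHS]mulrC ler_wpM2l ?powR_ge0//.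
    have [h0 h1] := andP h01.
    rewrite -powR_inv1// -powRrM mulrNN mul1r -[leRHS]powRr1//.
    by rewrite ler_powR//; lra.
  move=> i; have [d1 d2] := hd i.
  have : \sum_k (w i k - w (pi i) k) ^+ 2 <=
    2 * (\sum_k (g i (T k) - g (pi i) (T k)) ^+ 2) +
    2 * (\sum_k (g i (T' k) - g (pi i) (T' k)) ^+ 2); last by lra.
  rewrite !mulr_sumr -big_split; apply: ler_sum => k _ /=.
  rewrite /w; move: (g i (T k)) (g i (T' k)) (g (pi i) (T k)) (g (pi i) (T' k)) => a b c d'.
  by have := sqr_ge0 ((b - d') + (a - c)); nra.
- by rewrite (_ : 8 * (8 * A) = 64 * A); [exact: size_chain|ring].
Qed.

(** [small] is put into both events so that chaining has its diameters. In units of [exp (- y)],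
    symmetrization costs [2 * 2] and the second moments another 2. *)
Lemma uniform_deviation :
  Pr q (fun T => [exists i, n%:R * eps <= \sum_k (mean i - g i (T k))]) <=
  6 * expR (- y).
Proof.
have s2 : Pr q (predC small) <= 2 * expR (- y).
  apply: le_trans uniform_second_moment; apply: Pr_le => // T.
  by rewrite /small /= negb_forall => /existsP[i]; rewrite -ltNge => hi; apply/existsP; exists i.
(* With [y >= 3], [small] fails with probability at most 1/4; Bernstein's 1/4 then leaves the one
   half that [ghost] asks of the good event. *)
have ey : 2 * expR (- y) <= 4^-1.
  have : 8 <= expR y.
    apply: (@le_trans _ _ (expR 3)); last by rewrite ler_expR; exact: y_ge3.
    have -> : 8 = 2 ^+ 3 :> R by ring.
    have -> : 3 = 1 * 3%:R :> R by ring.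
    rewrite expRM_natr lerXn2r ?nnegrE ?expR_ge0//.
    by apply: le_trans (expR_ge1Dx _); lra.
  have := expRxMexpNx_1 y; have := expR_gt0 y; have := expR_gt0 (- y).
  by move: (expR y) (expR (- y)) => u v; nra.
have main : Pr q (fun T => [exists i,
    (n%:R * eps <= \sum_k (mean i - g i (T k))) && small T]) <= 2 * (2 * expR (- y)).
  apply: (ghost q_ge0 q_sum1 (Bad := fun i T =>
     (n%:R * eps <= \sum_k (mean i - g i (T k))) && small T)
    (Good := fun i T => (\sum_k (mean i - g i (T k)) < n%:R * (eps / 2)) && small T)).
    move=> i; set G := fun T => _.
    have : Pr q (predC G) <= 2^-1; last by rewrite Pr_compl//; lra.
    apply: (@le_trans _ _ (Pr q (fun T => (n%:R * (eps / 2) <= \sum_k (mean i - g i (T k)))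
      || ~~ small T))).
      by apply: Pr_le => // T; rewrite /G /= negb_and -leNgt.
    apply: le_trans (Pr_orb _ _ _) _ => //.
    have := bernstein_lower B_gt0 tau_gt0 _ (g_bound i) (g_var i) size_var size_bound.
    rewrite divr_gt0// => /(_ isT); rewrite -/(mean i) => b1.
    by move: s2 b1; rewrite /predC /=; lra.
  exact: chained.
apply: (@le_trans _ _ (Pr q (fun T => [exists i,
    (n%:R * eps <= \sum_k (mean i - g i (T k))) && small T] || ~~ small T))).
  apply: Pr_le => // T /existsP[i hi]; have [sT|_] /= := boolP (small T).
    by rewrite orbF; apply/existsP; exists i; rewrite hi.
  by rewrite orbT.
apply: le_trans; first exact: (Pr_orb q_ge0 (fun T => [exists i,
    (n%:R * eps <= \sum_k (mean i - g i (T k))) && small T]) (predC small)).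
by move: s2 main; rewrite /predC /=; lra.
Qed.

End EmpiricalProcess.

(** * Integration and rectangles *)

Section IntegralNullExt.
Context d (T : measurableType d) (R : realType) (mu : {measure set T -> \bar R}).
Local Open Scope ereal_scope.
Import HBNNSimple.

(* No measurability of [f] and [g] is needed: [\int] is a supremum over simple
   functions, which can be cut off outside [E]. *)
Lemma integral_null_ext (E : set T) (f g : T -> \bar R) :
  measurable E -> mu (~` E) = 0 -> (forall x, E x -> f x = g x) ->
  \int[mu]_x f x = \int[mu]_x g x.
Proof.
move=> mE E0.
suff key (u v : T -> \bar R) : (forall x, 0 <= u x) -> (forall x, 0 <= v x) ->
    (forall x, E x -> u x = v x) -> \int[mu]_x u x <= \int[mu]_x v x.
  have keye (u v : T -> \bar R) : (forall x, 0 <= u x) -> (forall x, 0 <= v x) ->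
      (forall x, E x -> u x = v x) -> \int[mu]_x u x = \int[mu]_x v x.
    move=> u0 v0 uv; apply/eqP; rewrite eq_le !key// => x Ex.
    by rewrite uv.
  move=> fg; rewrite integralE [RHS]integralE; congr (_ - _); apply: keye => // x Ex.
    by rewrite !funeposE fg.
  by rewrite !funenegE fg.
move=> u0 v0 uv; rewrite !ge0_integralTE//.
apply: ge_ereal_sup => _ [h /= hu <-].
apply: ereal_sup_ubound; exists (proj_nnsfun h mE) => /=.
  move=> x; rewrite mindicE; have [xE|xE] := boolP (x \in E).
    by rewrite mulr1 -uv ?hu//; rewrite inE in xE.
  by rewrite mulr0.
rewrite -!integralT_nnsfun; apply: ae_eq_integral => //.
- exact/measurable_EFinP/measurable_funP.
- exact/measurable_EFinP/measurable_funP.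
exists (~` E); split => //; first exact: measurableC.
move=> x /= H Ex; apply: H => _; congr EFin.
by rewrite /= mindicE mem_set// mulr1.
Qed.

End IntegralNullExt.

Section Caratheodory.
Context d (T : measurableType d) (R : realType).
Import HBSimple.

(** [f] is a pointwise limit of simple functions. On each of the finitely many level sets of a
    simple function only a section [phi ^~ r] appears, and continuity in the second variable passes
    to the limit. *)
Lemma measurable_fun_caratheodory (phi : T -> R -> R) (f : T -> R) :
  (forall t, measurable_fun [set: T] (phi ^~ t)) ->
  (forall z, continuous (phi z)) ->
  measurable_fun [set: T] f ->
  measurable_fun [set: T] (fun z => phi z (f z)).
Proof.
move=> mphi cphi mf.
have /measurable_EFinP mfE := mf.
have [s hs] := approximation_sfun measurableT mfE.
apply: (@measurable_fun_cvg _ _ _ _ (fun m z => phi z (s m z))).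
  move=> m _ A mA; rewrite setTI.
  have -> : (fun z => phi z (s m z)) @^-1` A =
      \bigcup_(r in range (s m)) ((s m @^-1` [set r]) `&` (phi ^~ r @^-1` A)).
    apply/seteqP; split => [z Az|z [r _ [/= <-]]//].
    by exists (s m z) => //; exists z.
  apply: fin_bigcup_measurable; first exact: fimfunP.
  move=> r _; apply: measurableI; first exact: measurable_funPTI.
  by rewrite -[X in measurable X]setTI; exact: mphi.
move=> z _; apply: continuous_cvg; first exact: cphi.
have := hs z Logic.I.
move=> /fine_cvg; exact.
Qed.

End Caratheodory.

Section Rectangles.
Context d (Z : measurableType d) (R : realType) (P : probability Z R).
Local Open Scope ereal_scope.

(* Integrate out one coordinate at a time: no product measure on [Z ^ n] is needed. *)
Lemma rect_sum_le (n : nat) (J : finType) (b : J -> \bar R) (D : J -> 'I_n -> set Z)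
    (a : nat -> \bar R) (C : nat -> 'I_n -> set Z) :
  (forall j, 0 <= b j) -> (forall k, 0 <= a k) ->
  (forall j i, measurable (D j i)) -> (forall k i, measurable (C k i)) ->
  (forall t : 'I_n -> Z, \sum_j b j * \prod_i (\1_(D j i) (t i))%:E <=
     \sum_(k <oo) a k * \prod_i (\1_(C k i) (t i))%:E) ->
  \sum_j b j * \prod_i P (D j i) <= \sum_(k <oo) a k * \prod_i P (C k i).
Proof.
elim: n b D a C => [|n IH] b D a C b0 a0 mD mC h.
  have := h (fun i : 'I_0 => match notF (ltn_ord i) with end).
  under eq_bigr do rewrite big_ord0.
  under [X in _ <= X -> _]eq_eseriesr do rewrite big_ord0.
  under [in X in _ -> X]eq_bigr do rewrite big_ord0.
  by under [X in _ -> _ <= X]eq_eseriesr do rewrite big_ord0.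
under eq_bigr do rewrite big_ord_recl muleA.
under eq_eseriesr do rewrite big_ord_recl muleA.
(* The mass of the first coordinate moves into the weights, which is why the statement carries
   general [b] and [a]. *)
apply: (IH (fun j => b j * P (D j ord0)) (fun j i => D j (lift ord0 i))
  (fun k => a k * P (C k ord0)) (fun k i => C k (lift ord0 i))) => //.
- by move=> j; rewrite mule_ge0.
- by move=> k; rewrite mule_ge0.
move=> t.
pose Q j := \prod_(i < n) (\1_(D j (lift ord0 i)) (t i))%:E : \bar R.
pose Q' k := \prod_(i < n) (\1_(C k (lift ord0 i)) (t i))%:E : \bar R.
have Q0 j : 0 <= Q j by apply: prode_ge0 => i _; rewrite lee_fin.
have Q'0 j : 0 <= Q' j by apply: prode_ge0 => i _; rewrite lee_fin.
have hz z : \sum_j (b j * Q j) * (\1_(D j ord0) z)%:E <=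
    \sum_(k <oo) (a k * Q' k) * (\1_(C k ord0) z)%:E.
  have := h (fun i => oapp t z (unlift ord0 i)).
  under eq_bigr do rewrite big_ord_recl.
  under [X in _ <= X -> _]eq_eseriesr do rewrite big_ord_recl.
  rewrite unlift_none /=.
  under eq_bigr => j _.
    under eq_bigr do rewrite liftK /=.
    rewrite (muleC _ (\prod_(i < n) _)) muleA -/(Q j); over.
  under [X in _ <= X -> _]eq_eseriesr => k _.
    under eq_bigr do rewrite liftK /=.
    rewrite (muleC _ (\prod_(i < n) _)) muleA -/(Q' k); over.
  by [].
have : \int[P]_z (\sum_j (b j * Q j) * (\1_(D j ord0) z)%:E) <=
    \int[P]_z (\sum_(k <oo) (a k * Q' k) * (\1_(C k ord0) z)%:E).
  apply: ge0_le_integral => //.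
  - by move=> z _; apply: sume_ge0 => j _; rewrite !mule_ge0// lee_fin.
  - apply: emeasurable_sum => j; apply: measurable_funeM.
    by apply/measurable_EFinP; exact: measurable_indic.
  - apply: (@ge0_emeasurable_sum _ _ _ _ _ xpredT) => k.
      by move=> z _ _; rewrite !mule_ge0// lee_fin.
    move=> _; apply: measurable_funeM.
    by apply/measurable_EFinP; exact: measurable_indic.
rewrite ge0_integral_sum//; last 2 first.
- move=> j; apply: measurable_funeM.
  by apply/measurable_EFinP; exact: measurable_indic.
- by move=> j z _; rewrite !mule_ge0// lee_fin.
rewrite integral_nneseries//; last 2 first.
- move=> j; apply: measurable_funeM.
  by apply/measurable_EFinP; exact: measurable_indic.
- by move=> j z _; rewrite !mule_ge0// lee_fin.
under eq_bigr => j _.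
  rewrite ge0_integralZl ?mule_ge0//; last by apply/measurable_EFinP; exact: measurable_indic.
  rewrite integral_indic// setIT muleAC; over.
under [X in _ <= X -> _]eq_eseriesr => k _.
  rewrite ge0_integralZl ?mule_ge0//; last by apply/measurable_EFinP; exact: measurable_indic.
  rewrite integral_indic// setIT muleAC; over.
by [].
Qed.

End Rectangles.

Section OuterProbability.
Context {R : realType} {X : pointedType} {opn : set (set X)}.
Notation Z := (borelType opn * R)%type.
Variable P : probability Z R.

(** Any countable cover of [A] by rectangles also covers the disjoint good products of cells, and
    [rect_sum_le] compares the masses without [A] being measurable. *)
Lemma outer_prob_n_ge (n : nat) (S : finType) (cell : S -> set Z)
    (G : pred {ffun 'I_n -> S}) (A : set ('I_n -> X * R)) :
  (forall s, measurable (cell s)) ->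
  (forall s s' z, cell s z -> cell s' z -> s = s') ->
  (forall T, G T -> forall t : 'I_n -> Z, (forall i, cell (T i) (t i)) -> A t) ->
  (\sum_(T | G T) \prod_i P (cell (T i)) <= outer_prob_n P A)%E.
Proof.
move=> mcell dcell GA; apply: le_ereal_inf_tmp => _ [C [mC AC] <-].
rewrite big_mkcond/= [leLHS](_ : _ = \sum_T (G T)%:R%:E * \prod_i P (cell (T i)))%E; last first.
  by apply: eq_bigr => T _; case: (G T); rewrite ?mul1e ?mul0e.
rewrite [leRHS](_ : _ = \sum_(k <oo) 1 * \prod_i P (C k i))%E; last first.
  by apply: eq_eseriesr => k _; rewrite mul1e.
apply: rect_sum_le => //.
move=> t.
under eq_bigr do rewrite prodEFin -EFinM.
rewrite sumEFin.
have ind0 T : \prod_i \1_(cell (T i)) (t i) = (`[< forall i, cell (T i) (t i) >])%:R :> R.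
  case: asboolP => [h|/existsNP[i hi]].
    by rewrite big1// => i _; rewrite indicE mem_set.
  by rewrite (bigD1 i)//= indicE memNset// mul0r.
(* At most one product of cells contains [t], so the left side is at most 1 there, and if it is 1
   some covering rectangle contains [t]. *)
have [[T0 /andP[GT0 /asboolP cT0]]|hn] :=
    pselect (exists T, G T && `[< forall i, cell (T i) (t i) >]); last first.
  rewrite big1 => [|T _].
    by apply: nneseries_ge0 => k _ _; rewrite mul1e; apply: prode_ge0 => i _; rewrite lee_fin.
  rewrite ind0 -natrM mulnb; case: (boolP (_ && _)) => // h.
  by exfalso; apply: hn; exists T.
have [k _ hk] := AC _ (GA _ GT0 t cT0).
apply: (@le_trans _ _ 1%E).
  under eq_bigr do rewrite ind0 -natrM mulnb.
  rewrite (bigD1 T0)//= big1 ?addr0; first by rewrite lee_fin lern1 leq_b1.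
  move=> T TT0; case: (boolP (_ && _)) => // /andP[_ /asboolP h].
  by move/eqP: TT0 => []; apply/ffunP => i; apply: dcell (h i) (cT0 i).
rewrite (@nneseriesD1 _ _ k)//; last first.
  by move=> i _; rewrite mul1e; apply: prode_ge0 => j _; rewrite lee_fin.
rewrite mul1e [X in (X + _)%E](_ : _ = 1%E); last first.
  by rewrite big1// => i _; rewrite indicE mem_set.
rewrite leeDl//; apply: nneseries_ge0 => i _ _.
by rewrite mul1e; apply: prode_ge0 => j _; rewrite lee_fin.
Qed.

End OuterProbability.

(** * Discretization of the distribution *)

Section Discretization.
Context {R : realType} {X : pointedType} {opn : set (set X)}.
Notation Z := (borelType opn * R)%type.
Variable P : probability Z R.

(** A cell records the integer parts of all [(g i z + B) / eta] simultaneously. *)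
Lemma quantize (I : finType) (g : I -> Z -> R) (B eta : R) : 0 < eta ->
  (forall i, measurable_fun [set: Z] (g i)) -> (forall i z, `|g i z| <= B) ->
  exists (S : finType) (cell : S -> set Z) (rep : S -> Z),
   [/\ forall s, measurable (cell s),
       forall s s' z, cell s z -> cell s' z -> s = s',
       forall z, exists s, cell s z &
       forall s z i, cell s z -> `|g i z - g i (rep s)| <= eta].
Proof.
move=> eta0 mg gB.
pose h i z := (g i z + B) / eta.
have h0 i z : 0 <= h i z.
  by rewrite divr_ge0 ?(ltW eta0)//; have := gB i z; rewrite ler_norml; lra.
pose M := Num.truncn (2 * B / eta).
have hM i z : (Num.truncn (h i z) < M.+1)%N.
  rewrite ltnS; apply: le_truncn; rewrite ler_pM2r ?invr_gt0//.
  by have := gB i z; rewrite ler_norml; lra.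
pose cell (s : {ffun I -> 'I_M.+1}) : set Z :=
  [set z | forall i, h i z \in `[(s i)%:R, (s i).+1%:R[].
(* An empty cell receives the default [point]; closeness is claimed only for members of a cell. *)
pose rep s : Z := xget point (cell s).
exists {ffun I -> 'I_M.+1}, cell, rep; split.
- move=> s.
  have -> : cell s = \bigcap_(i in [set: I]) (h i @^-1` [set` `[(s i)%:R, (s i).+1%:R[]).
    by apply/seteqP; split => [z hz i _|z hz i]; [exact: hz|exact: (hz i)].
  apply: fin_bigcap_measurable; first exact: finite_finset.
  move=> i _; rewrite -[X in measurable X]setTI.
  have mh : measurable_fun [set: Z] (h i).
    by apply: measurable_funM => //; apply: measurable_funD.
  by apply: mh => //; exact: measurable_itv.
- move=> s s' z hs hs'; apply/ffunP => i; apply/val_inj => /=.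
  have := hs i; have := hs' i; rewrite !in_itv/= => /andP[a1 a2] /andP[b1 b2].
  apply/eqP; rewrite eqn_leq; apply/andP; split; rewrite -ltnS -(ltr_nat R).
    exact: le_lt_trans b1 a2.
  exact: le_lt_trans a1 b2.
- move=> z; exists [ffun i => Ordinal (hM i z)] => i.
  by rewrite ffunE in_itv/= truncn_itv.
- move=> s z i hz.
  have := xgetPex point (ex_intro (cell s) z hz).
  rewrite -/(rep s) => /(_ i); have := hz i.
  rewrite !in_itv/= -natr1.
  move=> /andP[a1 a2] /andP[b1 b2].
  have : `|h i z - h i (rep s)| <= 1 by rewrite ler_norml; lra.
  rewrite /h -mulrBl opprD addrACA subrr addr0 normrM [ `|eta^-1|]gtr0_norm ?invr_gt0//.
  by rewrite ler_pdivrMr// mul1r.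
Qed.

Variables (S : finType) (cell : S -> set Z).
Hypothesis mcell : forall s, measurable (cell s).
Hypothesis dcell : forall s s' z, cell s z -> cell s' z -> s = s'.
Hypothesis ccell : forall z, exists s, cell s z.

Let q s : R := fine (P (cell s)).

Let qE s : P (cell s) = (q s)%:E.
Proof. by rewrite /q fineK// fin_num_measure. Qed.

Let q_ge0 s : 0 <= q s.
Proof. exact: fine_ge0. Qed.

Let step (phi : S -> R) z := \sum_s phi s * \1_(cell s) z.

Let stepE phi s z : cell s z -> step phi z = phi s.
Proof.
move=> sz; rewrite /step (bigD1 s)//= indicE mem_set// mulr1 big1 ?addr0// => s' ss'.
rewrite indicE memNset ?mulr0// => s'z.
by move/eqP : ss'; apply; exact: dcell s'z sz.
Qed.

Let mstep phi : measurable_fun [set: Z] (step phi).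
Proof.
by apply: measurable_sum => s; apply: measurable_funM => //; exact: measurable_indic.
Qed.

Let integral_step phi : (forall s, 0 <= phi s) ->
  (\int[P]_z (step phi z)%:E = (\sum_s q s * phi s)%:E)%E.
Proof.
move=> phi0; under eq_integral do rewrite /step -sumEFin.
rewrite ge0_integral_sum//.
- rewrite -sumEFin; apply: eq_bigr => s _.
  under eq_integral do rewrite EFinM.
  rewrite ge0_integralZl ?lee_fin//; last by apply/measurable_EFinP; exact: measurable_indic.
  by rewrite integral_indic// setIT [X in (_ * X)%E](qE s) -EFinM mulrC.
- move=> s; by apply/measurable_EFinP; apply: measurable_funM => //; exact: measurable_indic.
- by move=> s z _; rewrite lee_fin mulr_ge0.
Qed.

Lemma cells_sum1 : \sum_s q s = 1.
Proof.
have := @integral_step (fun=> 1) (fun=> ler01).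
under eq_integral => z _.
  have [s sz] := ccell z; rewrite (stepE _ sz); over.
rewrite integral_cst// [X in (_ * X)%E]probability_setT mule1 => -[->].
by apply: eq_bigr => s _; rewrite mulr1.
Qed.

Lemma integral_le_cells (f : Z -> R) (phi : S -> R) :
  measurable_fun [set: Z] f -> (forall z, 0 <= f z) ->
  (forall s z, cell s z -> f z <= phi s) -> (forall s, 0 <= phi s) ->
  (\int[P]_z (f z)%:E <= (\sum_s q s * phi s)%:E)%E.
Proof.
move=> mf f0 fphi phi0; rewrite -integral_step//; apply: ge0_le_integral => //.
- by move=> z _; rewrite lee_fin.
- exact/measurable_EFinP.
- by apply/measurable_EFinP; exact: mstep.
- by move=> z _; rewrite lee_fin; have [s sz] := ccell z; rewrite (stepE _ sz) fphi.
Qed.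

Lemma cells_le_integral (f : Z -> R) (phi : S -> R) :
  measurable_fun [set: Z] f -> (forall z, 0 <= f z) ->
  (forall s z, cell s z -> phi s <= f z) -> (forall s, 0 <= phi s) ->
  ((\sum_s q s * phi s)%:E <= \int[P]_z (f z)%:E)%E.
Proof.
move=> mf f0 fphi phi0; rewrite -integral_step//; apply: ge0_le_integral => //.
- by move=> z _; rewrite lee_fin; have [s sz] := ccell z; rewrite (stepE _ sz).
- by apply/measurable_EFinP; exact: mstep.
- exact/measurable_EFinP.
- by move=> z _; rewrite lee_fin; have [s sz] := ccell z; rewrite (stepE _ sz) fphi.
Qed.

End Discretization.

Section UniformDeviation.
Context {R : realType} {X : pointedType} {opn : set (set X)}.
Notation Z := (borelType opn * R)%type.

(** Quantizing raises the variance bound from [tau] to [4 tau] and uses up half of [eps]; this is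
    the origin of 16, of 96 and of [eps / 4] in the size conditions. *)
Lemma uniform_deviation_outer (P : probability Z R) (E : set Z) (n : nat)
  (I : finType) (g : I -> Z -> R) (m : I -> R) (A h B tau rho y eps r : R)
  (G : set ('I_n -> X * R)) :
  measurable E -> P E = 1%E -> (0 < n)%N ->
  0 <= A -> 0 < B -> 0 < tau -> 16 * tau <= rho -> 3 <= y -> 0 < h < 1 ->
  (forall i, measurable_fun [set: Z] (g i)) ->
  (forall i z, `|g i z| <= B) ->
  (forall i, \int[P]_z (g i z)%:E = (m i)%:E)%E ->
  (forall i, \int[P]_z (g i z ^+ 2)%:E <= tau%:E)%E ->
  (forall (t : 'I_n -> Z) d, 0 < d -> exists (N : nat) (code : I -> 'I_N),
    N%:R <= expR (A * d `^ (- h)) /\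
    forall i j, code i = code j -> \sum_k (g i (t k) - g j (t k)) ^+ 2 <= n%:R * d) ->
  2 * B ^+ 2 * (2 * (A * rho `^ (- h)) + y) <= n%:R * rho ->
  0 < eps -> 0 < r < 1 -> 4 `^ h <= 4 * r ^+ 2 -> 2 <= 4 * r ^+ 2 ->
  96 * tau <= n%:R * (eps / 4) ^+ 2 -> 24 * B <= n%:R * (eps / 4) ->
  32 * (256 * rho) * (64 * A * (256 * rho) `^ (- h) + y) <=
    n%:R * (eps * (1 - r) / 8) ^+ 2 ->
  (forall t : 'I_n -> Z, (forall k, E (t k)) ->
    (forall i, \sum_k (m i - g i (t k)) < n%:R * eps) -> G t) ->
  ((1 - 6 * expR (- y))%:E <= outer_prob_n P G)%E.
Proof.
move=> mE PE n0 A0 B0 tau0 taurho y3 h01 mg gB mint gvar ent c1 e0 r01 rh r2 c2 c3 c4 hG.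
have n0R : 0 < n%:R :> R by rewrite ltr0n.
(* [eta <= eps / 8] pays for moving both means and sample values; [eta <= 1] and [eta <= tau] give
   [eta^2 <= tau], which pays for the variance. *)
pose eta := Num.min (eps / 8) (Num.min 1 tau).
have eta0 : 0 < eta by rewrite /eta !lt_min; lra.
have eta1 : eta <= eps / 8 by rewrite /eta ge_min lexx.
have eta2 : eta ^+ 2 <= tau.
  have e1 : eta <= 1 by rewrite /eta !ge_min lexx !orbT.
  have e2 : eta <= tau by rewrite /eta !ge_min lexx !orbT.
  by rewrite expr2; nra.
have [S [cell [rep [mcell dcell ccell hrep]]]] := quantize eta0 mg gB.
pose q s : R := fine (P (cell s)).
have q0 s : 0 <= q s by exact: fine_ge0.
have q1 : \sum_s q s = 1 by exact: cells_sum1.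
pose G0 (T : {ffun 'I_n -> S}) :=
  [exists i, n%:R * (eps / 2) <= \sum_k (\sum_s q s * g i (rep s) - g i (rep (T k)))].
have key : Pr q G0 <= 6 * expR (- y).
  apply: (@uniform_deviation R S q q0 q1 n I (fun i s => g i (rep s)) A h B (4 * tau) rho y
     n0 A0 B0 _ _ y3 h01 _ _ _ c1 (eps / 2) r _ r01 rh r2 _ _ _) => //.
  - by lra.
  - by lra.
  - move=> i; rewrite -lee_fin.
    apply: (@le_trans _ _ (\int[P]_z (2 * g i z ^+ 2 + 2 * tau)%:E)%E).
      apply: cells_le_integral => //.
      + apply: measurable_funD => //; apply: measurable_funM => //.
        exact: measurable_funX.
      + by move=> z; have := sqr_ge0 (g i z); lra.
      + move=> s z sz; have := hrep s z i sz.
        move: (g i z) (g i (rep s)) => a b ab.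
        have : (a - b) ^+ 2 <= eta ^+ 2.
          by rewrite -[(a - b) ^+ 2]real_normK ?num_real// lerXn2r ?nnegrE ?(ltW eta0).
        have := sqr_ge0 (2 * a - b); nra.
      + by move=> s; exact: sqr_ge0.
    under eq_integral do rewrite EFinD EFinM.
    rewrite ge0_integralD//=; last 3 first.
    + by move=> z _; rewrite lee_fin mulr_ge0// sqr_ge0.
    + apply/measurable_EFinP; apply: measurable_funM => //; exact: measurable_funX.
    + by move=> z _; rewrite lee_fin; lra.
    rewrite ge0_integralZl//; last 2 first.
    + by apply/measurable_EFinP; exact: measurable_funX.
    + by move=> z _; rewrite lee_fin sqr_ge0.
    rewrite integral_cst// [X in ((2 * tau)%:E * X)%E]probability_setT mule1.
    apply: (@le_trans _ _ (2%:E * tau%:E + (2 * tau)%:E)%E).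
      by rewrite leeD2r// lee_pmul2l.
    by rewrite -EFinM -EFinD lee_fin; lra.
  - by move=> T d d0; have := ent (rep \o T) d d0.
  - by lra.
  - by rewrite (_ : eps / 2 / 2 = eps / 4); [lra|field].
  - by rewrite (_ : eps / 2 / 2 = eps / 4); [lra|field].
  - by rewrite (_ : eps / 2 * (1 - r) / 4 = eps * (1 - r) / 8); [lra|field].
have mbound i : m i <= \sum_s q s * g i (rep s) + eta.
  have : (\int[P]_z (g i z + B)%:E <= (\sum_s q s * (g i (rep s) + eta + B))%:E)%E.
    apply: integral_le_cells => //.
    - exact: measurable_funD.
    - by move=> z; have := gB i z; rewrite ler_norml; lra.
    - by move=> s z sz; have := hrep s z i sz; rewrite ler_norml; lra.
    - by move=> s; have := gB i (rep s); rewrite ler_norml; lra.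
  under eq_integral do rewrite EFinD.
  rewrite integralD//=; last 2 first.
  - apply: (measurable_bounded_integrable measurableT) => //.
      by rewrite [X in (X < _)%E]probability_setT ltry.
    exists B; split; first by rewrite num_real.
    by move=> x Bx z _; exact: le_trans (gB i z) (ltW Bx).
  - apply: (measurable_bounded_integrable measurableT (f := cst B)) => //.
      by rewrite [X in (X < _)%E]probability_setT ltry.
    exists B; split; first by rewrite num_real.
    by move=> x Bx z _; rewrite /= gtr0_norm// ltW.
  rewrite mint integral_cst// [X in (_ * X)%E]probability_setT mule1 -EFinD lee_fin.
  under eq_bigr do rewrite !mulrDr.
  by rewrite !big_split/= -!mulr_suml q1; lra.
apply: le_trans; last first.
  (* Cutting the cells by [E] confines the samples to a set of full measure and, by [PcE], leaves
     the masses unchanged. *)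
  apply: (@outer_prob_n_ge R X opn P n S (fun s => cell s `&` E) (fun T => ~~ G0 T) G).
- by move=> s; exact: measurableI.
- by move=> s s' z [sz _] [s'z _]; exact: dcell sz s'z.
- move=> T /existsPn nG t ht; apply: hG => [k|i]; first by have [] := ht k.
  have := nG i; rewrite -ltNge => hi.
  apply: (@le_lt_trans _ _ (\sum_(k < n) (\sum_s q s * g i (rep s) - g i (rep (T k)) + 2 * eta))).
    apply: ler_sum => k _; have [ck _] := ht k.
    by have := hrep _ _ i ck; have := mbound i; rewrite ler_norml; lra.
  rewrite big_split/= sumr_const card_ord -[_ *+ n]mulr_natl.
  have : n%:R * (2 * eta) <= n%:R * (eps / 4) by rewrite ler_pM2l//; lra.
  by lra.
have PcE s : P (cell s `&` E) = (q s)%:E.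
  rewrite /q fineK ?fin_num_measure//.
  have -> : P (cell s) = (P (cell s `&` E) + P (cell s `\` E))%E.
    by rewrite addeC -measureDI//.
  rewrite [X in (_ + X)%E](_ : _ = 0%E) ?adde0//.
  apply/eqP; rewrite eq_le measure_ge0 andbT.
  apply: (@le_trans _ _ (P (~` E))).
    apply: le_measure; rewrite ?inE; [exact: measurableD|exact: measurableC|].
    by move=> z [].
  by rewrite probability_setC// PE subee.
apply: (@le_trans _ _ (Pr q (predC G0))%:E).
  by rewrite lee_fin Pr_compl//; lra.
rewrite /Pr -sumEFin; apply: lee_sum => T _.
by rewrite /prodw -prodEFin; under eq_bigr do rewrite -PcE.
Qed.

End UniformDeviation.

(** * Reproducing kernel Hilbert spaces over a compact space *)

Section RKHSAlgebra.
Context (R : realType) (X : Type) (H : set (X -> R)).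
Variables (ip : (X -> R) -> (X -> R) -> R) (k : X -> X -> R).
Hypothesis hH : is_RKHS H ip k.

Lemma RKHS_comb a f g : H f -> H g -> H (fun x => a * f x + g x).
Proof. by case: hH => -[_ h] _ _ _ _; exact: h. Qed.

Lemma RKHS_scale a f : H f -> H (fun x => a * f x).
Proof.
move=> Hf; have [[H0 _] _ _ _ _] := hH.
have := RKHS_comb a Hf H0; congr (H _).
by apply/funext => x; rewrite addr0.
Qed.

Lemma RKHS_comb2 a b f g : H f -> H g -> H (fun x => a * f x + b * g x).
Proof. by move=> Hf Hg; apply: RKHS_comb => //; exact: RKHS_scale. Qed.

Lemma ip_sym f g : H f -> H g -> ip f g = ip g f.
Proof. by case: hH => _ [_ [h _]] _ _ _; exact: h. Qed.

Lemma ip_ge0 f : H f -> 0 <= ip f f.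
Proof. by case: hH => _ [_ [_ [h _]]] _ _ _; exact: h. Qed.

Lemma ip_combl a f g h : H f -> H g -> H h ->
  ip (fun x => a * f x + g x) h = a * ip f h + ip g h.
Proof. by case: hH => _ [hl _] _ _ _; exact: hl. Qed.

Lemma ip_scalel a f h : H f -> H h -> ip (fun x => a * f x) h = a * ip f h.
Proof.
move=> Hf Hh; have [[H0 _] _ _ _ _] := hH.
have e0 : ip (fun=> 0) h = 0.
  have := ip_combl 1 H0 H0 Hh.
  rewrite (_ : (fun x => 1 * 0 + 0) = (fun=> 0)); first by lra.
  by apply/funext => x; rewrite mulr0 addr0.
have := ip_combl a Hf H0 Hh; rewrite e0 addr0 => <-.
by congr ip; apply/funext => x; rewrite addr0.
Qed.

Lemma ip_comb2 a b f g : H f -> H g ->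
  ip (fun x => a * f x + b * g x) (fun x => a * f x + b * g x) =
  a ^+ 2 * ip f f + 2 * a * b * ip f g + b ^+ 2 * ip g g.
Proof.
move=> Hf Hg; have Hbg := RKHS_scale b Hg; have Hc := RKHS_comb2 a b Hf Hg.
rewrite ip_combl// (ip_sym Hf Hc) (ip_sym Hbg Hc) !ip_combl//.
by rewrite !(ip_scalel _ Hg)// (ip_sym Hf Hbg) (ip_sym Hg Hbg)
  !(ip_scalel _ Hg)// (ip_sym Hg Hf); ring.
Qed.

Lemma Hnorm_sqr f : H f -> Hnorm ip f ^+ 2 = ip f f.
Proof. by move=> Hf; rewrite /Hnorm sqr_sqrtr// ip_ge0. Qed.

Lemma Hnorm_ge0 f : 0 <= Hnorm ip f.
Proof. exact: sqrtr_ge0. Qed.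

Lemma Hnorm_scale a f : H f -> Hnorm ip (fun x => a * f x) = `|a| * Hnorm ip f.
Proof.
move=> Hf; rewrite /Hnorm ip_scalel ?(ip_sym Hf) ?ip_scalel//; [|exact: RKHS_scale..].
by rewrite mulrA -expr2 sqrtrM ?sqr_ge0// sqrtr_sqr.
Qed.

(** The gap between the two sides is [u (1 - u)] times the squared norm of [f - g]. *)
Lemma Hnorm_sqr_convex u f g : H f -> H g -> 0 <= u <= 1 ->
  Hnorm ip (fun x => u * f x + (1 - u) * g x) ^+ 2 <=
  u * Hnorm ip f ^+ 2 + (1 - u) * Hnorm ip g ^+ 2.
Proof.
move=> Hf Hg /andP[u0 u1].
rewrite !Hnorm_sqr//; last exact: RKHS_comb2.
have := ip_ge0 (RKHS_comb2 1 (-1) Hf Hg); rewrite !ip_comb2//.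
move: (ip f f) (ip f g) (ip g g) => a b c h.
have : 0 <= u * (1 - u) * (a - 2 * b + c).
  by apply: mulr_ge0; [apply: mulr_ge0; lra|lra].
lra.
Qed.

(** Positivity of the squared norm of [ip f f * g - ip f g * f]; if [ip f f = 0], definiteness makes
    [f] zero. *)
Lemma ip_cauchy_schwarz f g : H f -> H g -> ip f g ^+ 2 <= ip f f * ip g g.
Proof.
move=> Hf Hg; have f0 := ip_ge0 Hf; have g0 := ip_ge0 Hg.
have h a b : 0 <= a ^+ 2 * ip f f + 2 * a * b * ip f g + b ^+ 2 * ip g g.
  by rewrite -ip_comb2// ip_ge0//; exact: RKHS_comb2.
have [z|nz] := eqVneq (ip f f) 0.
  have -> : ip f g = 0; last by rewrite z expr0n mul0r.
  have [_ [_ [_ [_ /(_ f Hf z) fE]]] _ _ _] := hH.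
  rewrite -[RHS](mul0r (ip f g)) -ip_scalel// [in LHS]fE; congr (ip _ g).
  by apply/funext => x; rewrite mul0r.
have fp : 0 < ip f f by rewrite lt_def nz.
have := h (- ip f g) (ip f f); move: (ip f f) (ip f g) (ip g g) fp => a b c a0.
have -> : (- b) ^+ 2 * a + 2 * - b * a * b + a ^+ 2 * c = a * (a * c - b ^+ 2) by ring.
by rewrite pmulr_rge0// subr_ge0.
Qed.

Lemma RKHS_kernel_fun x : H (fun y => k y x).
Proof. by case: hH. Qed.

Lemma RKHS_eval f x : H f -> f x = ip f (fun y => k y x).
Proof. by case: hH => _ _ _ _; exact. Qed.

Lemma RKHS_eval_sqr f x : H f -> f x ^+ 2 <= ip f f * k x x.
Proof.
move=> Hf; rewrite (RKHS_eval x Hf); have Hk := RKHS_kernel_fun x.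
by rewrite (RKHS_eval x Hk); exact: ip_cauchy_schwarz.
Qed.

(** Cauchy-Schwarz against a difference of kernel sections. The modulus of continuity depends on [f]
    only through its norm, so balls of [H] are equicontinuous. *)
Lemma RKHS_dist_sqr f x x' : H f ->
  (f x - f x') ^+ 2 <= ip f f * (k x x - 2 * k x' x + k x' x').
Proof.
move=> Hf; have Hx := RKHS_kernel_fun x; have Hx' := RKHS_kernel_fun x'.
have Hd := RKHS_comb2 1 (-1) Hx Hx'.
have -> : f x - f x' = ip f (fun y => 1 * k y x + -1 * k y x').
  rewrite (ip_sym Hf Hd) ip_combl ?ip_scalel//; last exact: RKHS_scale.
  by rewrite !(ip_sym _ Hf)// -!RKHS_eval//; ring.
apply: (le_trans (ip_cauchy_schwarz Hf Hd)).
rewrite ip_comb2// -(RKHS_eval x Hx) -(RKHS_eval x' Hx') -(RKHS_eval x' Hx).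
by rewrite le_eqVlt; apply/orP; left; apply/eqP; ring.
Qed.

End RKHSAlgebra.

Section RKHSTopology.
Context (R : realType) (X : pseudoPMetricType R).
Hypothesis X_compact : compact [set: X].
Variables (H : set (X -> R)) (ip : (X -> R) -> (X -> R) -> R) (k : X -> X -> R).
Hypothesis hH : is_RKHS H ip k.
Hypothesis k_cont : continuous (fun q : X * X => k q.1 q.2).

Let kdist x x' := k x x - 2 * k x' x + k x' x'.

Let k_comp_cont (u w : X -> X) : continuous u -> continuous w ->
  continuous (fun x => k (u x) (w x)).
Proof.
move=> cu cw x.
apply: (@continuous_comp _ _ _ (fun x => (u x, w x)) (fun q : X * X => k q.1 q.2)).
  exact: cvg_pair (cu x) (cw x).
exact: k_cont.
Qed.

Let kdist_cont x : continuous (kdist x).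
Proof.
move=> x'; rewrite /kdist; apply: cvgD; last by apply: k_comp_cont => ?; exact: cvg_id.
apply: cvgB; first exact: cvg_cst.
apply: cvgM; first exact: cvg_cst.
by apply: k_comp_cont => ?; [exact: cvg_id|exact: cvg_cst].
Qed.

Lemma kernel_diag_bounded : exists M : R, forall x, k x x <= M.
Proof.
have ck : continuous (fun x => k x x) by apply: k_comp_cont => ?; exact: cvg_id.
have /compact_bounded[M [_ hM]] : compact [set k x x | x in [set: X]].
  by apply: continuous_compact => //; exact: continuous_subspaceT.
exists (M + 1) => x; apply: (le_trans (ler_norm _)); apply: (hM (M + 1)); first by lra.
by exists x.
Qed.

(** [sup] dominates a set only if the set is bounded above; here the bounded kernel diagonal
    provides this. *)
Lemma RKHS_le_supnorm f x : H f -> `|f x| <= supnorm f.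
Proof.
move=> Hf; have [M hM] := kernel_diag_bounded.
rewrite /supnorm; apply: sup_ubound; last by exists x.
exists (ip f f * M + 1) => _ [z _ <-].
have f0 := ip_ge0 hH Hf.
have := RKHS_eval_sqr hH z Hf; have := ler_wpM2l f0 (hM z).
rewrite -[f z ^+ 2]real_normK ?num_real//.
by move: (`|f z|) (ip f f * k z z) => a b; have := sqr_ge0 (a - 1); nra.
Qed.

Lemma supnorm_ge0 f : H f -> 0 <= supnorm f.
Proof. by move=> Hf; apply: le_trans (RKHS_le_supnorm point Hf). Qed.

Lemma RKHS_continuous f : H f -> continuous f.
Proof.
move=> Hf x; apply/cvgrPdist_lt => e e0.
have f0 := ip_ge0 hH Hf.
have c0 : 0 < e ^+ 2 / (ip f f + 1) by rewrite divr_gt0 ?exprn_gt0//; lra.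
have kxx : kdist x x = 0 by rewrite /kdist; ring.
have /cvgrPdist_lt /(_ _ c0) := @kdist_cont x x.
apply: filterS => x'; rewrite kxx sub0r normrN => hx'.
rewrite -(ltr_pXn2r (ltn0Sn 1)) ?nnegrE ?normr_ge0 ?(ltW e0)// real_normK ?num_real//.
apply: (le_lt_trans (RKHS_dist_sqr hH x x' Hf)).
have := le_lt_trans (ler_norm _) hx'; rewrite -/(kdist x x').
rewrite ltr_pdivlMr; last by lra.
have [kn|kp] := leP (kdist x x') 0; last by nra.
by move=> _; apply: le_lt_trans (_ : 0 < _); [rewrite mulr_ge0_le0|rewrite exprn_gt0].
Qed.

Lemma continuous_borel_measurable (f : X -> R) : continuous f ->
  measurable_fun [set: borelType (@open X)] (f : borelType (@open X) -> R).
Proof.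
move=> /continuousP cf; apply: (measurability _ (RGenOpens.measurableE R)).
move=> _ [_ [a [b ->] <-]]; rewrite setTI; apply: sub_sigma_algebra.
exact/cf/interval_open.
Qed.

Hypothesis hsup : forall f, H f -> supnorm f <= Hnorm ip f.

Lemma RKHS_le_Hnorm f x : H f -> `|f x| <= Hnorm ip f.
Proof. by move=> Hf; exact: le_trans (RKHS_le_supnorm x Hf) (hsup Hf). Qed.

(** Arzela-Ascoli by hand: finitely many balls of the kernel pseudometric cover [X], and a function
    is coded by its values at the centers up to [e]. Representatives are chosen in [F], so the net
    inherits its constraints; [f0] fills the codes that are not realized. *)
Lemma RKHS_net (F : set (X -> R)) (f0 : X -> R) (r eta : R) : 0 < eta -> 0 <= r ->
  F f0 -> (forall f, F f -> H f /\ Hnorm ip f <= r) ->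
  exists (I : finType) (fd : I -> X -> R), (forall i, F (fd i)) /\
    forall f, F f -> exists i, forall x, `|f x - fd i x| <= eta.
Proof.
move=> eta0 r0 Ff0 hF; have [e e0 etaE] : exists2 e, 0 < e & eta = 4 * e by exists (eta / 4); lra.
pose c := (e / (r + 1)) ^+ 2.
have c0 : 0 < c by rewrite exprn_gt0// divr_gt0//; lra.
have := X_compact; rewrite compact_cover.
move=> /(_ X [set: X] (fun x => kdist x @^-1` [set y | y < c])) [].
- by move=> x _; apply: open_comp => [y _|]; [exact: kdist_cont|exact: open_lt].
- by move=> x _; exists x => //=; rewrite /kdist (_ : _ + _ = 0)//; ring.
move=> D _ hD.
have equi f x x' : F f -> kdist x x' < c -> `|f x - f x'| <= e.
  move=> /hF[Hf fr] hx.
  rewrite -(ler_pXn2r (ltn0Sn 1)) ?nnegrE ?normr_ge0 ?(ltW e0)// real_normK ?num_real//.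
  apply: (le_trans (RKHS_dist_sqr hH x x' Hf)); rewrite -/(kdist x x').
  have nf0 := ip_ge0 hH Hf.
  have nfr : ip f f <= (r + 1) ^+ 2.
    rewrite -(Hnorm_sqr hH Hf); apply: lerXn2r; rewrite ?nnegrE ?Hnorm_ge0//; lra.
  have -> : e ^+ 2 = (r + 1) ^+ 2 * c by rewrite /c; field; lra.
  apply: (le_trans (ler_wpM2l nf0 (ltW hx))).
  by rewrite ler_wpM2r// ltW.
pose M := Num.truncn (2 * r / e).
have hM f x : F f -> (Num.truncn ((f x + r) / e) < M.+1)%N.
  move=> /hF[Hf fr]; rewrite ltnS; apply: le_truncn; rewrite ler_pM2r ?invr_gt0//.
  by have := ler_norm (f x); have := RKHS_le_Hnorm x Hf; lra.
pose code f : {ffun D -> 'I_M.+1} :=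
  [ffun x => inord (Num.truncn ((f (fsval x) + r) / e))].
have /choice[fd hfd] : forall s, exists f, F f /\
    ((exists2 f', F f' & code f' = s) -> code f = s).
  move=> s; have [[f Ff fs]|hn] := pselect (exists2 f', F f' & code f' = s).
    by exists f.
  by exists f0; split.
exists {ffun D -> 'I_M.+1}, fd; split; first by move=> s; have [] := hfd s.
move=> f Ff; exists (code f) => x.
have [Fd /(_ (ex_intro2 _ _ f Ff erefl))] := hfd (code f).
set f' := fd (code f) in Fd *; move=> cf.
have [x0 /= x0D hx0] := hD x Logic.I.
have h1 := equi f x0 x Ff hx0.
have h2 := equi f' x0 x Fd hx0.
have h3 : `|f x0 - f' x0| <= e.
  have /(congr1 val) /= := congr1 (fun s : {ffun D -> 'I_M.+1} => s [` x0D]%fset) cf.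
  rewrite !ffunE /= !inordK ?hM//.
  have pos g : F g -> 0 <= (g x0 + r) / e.
    move=> /hF[Hg gr]; rewrite divr_ge0 ?(ltW e0)//.
    by have := RKHS_le_Hnorm x0 Hg; rewrite ler_norml; lra.
  move=> E; have := truncn_itv (pos _ Ff); have := truncn_itv (pos _ Fd).
  rewrite E -natr1; move: ((Num.truncn ((f x0 + r) / e))%:R : R) => N.
  rewrite !ler_pdivlMr// !ltr_pdivrMr// => /andP[a1 a2] /andP[b1 b2].
  by rewrite ler_norml; apply/andP; split; nra.
have -> : f x - f' x = (f x0 - f' x0) - (f x0 - f x) + (f' x0 - f' x) by ring.
apply: (le_trans (ler_normD _ _)); have := ler_normB (f x0 - f' x0) (f x0 - f x).
by rewrite etaE; lra.
Qed.

End RKHSTopology.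

(** * Rates *)

Section Rates.
Variable R : realType.

(** For [den = 0], finiteness of [pow_ext] means [s <= 1], which is what [eps^0 = 1] expresses;
    otherwise the power is inverted. *)
Lemma pow_ext_le (s num den eps : R) : 0 <= s -> 0 < num -> 0 <= den -> 0 < eps ->
  (pow_ext s num den <= eps%:E)%E -> s <= eps `^ (den / num).
Proof.
move=> s0 num0 den0 eps0; rewrite /pow_ext.
have [->|denN0] := eqVneq den 0.
  rewrite mul0r powRr0; case: ltP => [/ltW//|_].
  by case: eqP => [->//|_]; rewrite leye_eq.
rewrite lee_fin => h.
have -> : s = (s `^ (num / den)) `^ (den / num).
  rewrite -powRrM -[LHS]powRr1//; congr (_ `^ _); field.
  by rewrite denN0 gt_eqF.
by apply: ge0_ler_powR; rewrite ?nnegrE ?powR_ge0 ?divr_ge0 ?(ltW num0) ?(ltW eps0).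
Qed.

Lemma powR_ge1_le_scale (C M e : R) : 1 <= C -> 0 <= M -> 0 <= e <= 1 ->
  (C * M) `^ e <= C * M `^ e.
Proof.
move=> C1 M0 /andP[e0 e1]; rewrite powRM//; last by lra.
rewrite ler_wpM2r ?powR_ge0// -[leRHS]powRr1; last by lra.
exact: ler_powR.
Qed.

Lemma gt0_powRD (z u w : R) : 0 < z -> z `^ (u + w) = z `^ u * z `^ w.
Proof. by move=> z0; apply: powRD; rewrite (gt_eqF z0) implybT. Qed.

(** The entropy term contains [B0^2 B0^(2h)], the square of [B0^(1+h)]: one factor is paid by the
    rate, the other by [rho^(1+h) >= (B0 eps)^(1+h)]. *)
Lemma rate_second_moment (a x n eps B0 h CA K rho : R) :
  0 < a -> 0 < x -> 0 < n -> 0 < eps -> 0 < B0 -> 0 < h -> 0 < CA ->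
  B0 * eps <= rho ->
  K * a * B0 `^ (1 + h) <= n * eps `^ (1 + h) -> K * x * B0 <= n * eps ->
  72 * CA <= K -> 144 <= K ->
  2 * (3 * B0) ^+ 2 * (2 * (a * CA * B0 `^ (2 * h) * rho `^ (- h)) + 4 * x) <= n * rho.
Proof.
move=> a0 x0 n0 eps0 B00 h0 CA0 rhoBe k2 k4 K72 K144.
set A := a * CA * B0 `^ (2 * h).
have Be0 : 0 < B0 * eps by rewrite mulr_gt0.
have rho0 : 0 < rho by lra.
have d1 : 144 * x * B0 ^+ 2 <= n * rho.
  apply: (@le_trans _ _ (n * (B0 * eps))); last by rewrite ler_pM2l.
  rewrite (_ : 144 * x * B0 ^+ 2 = 144 * x * B0 * B0); last by ring.
  rewrite (_ : n * (B0 * eps) = n * eps * B0); last by ring.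
  rewrite ler_pM2r//.
  apply: le_trans k4.
  by rewrite ler_pM2r// ler_pM2r.
have d2 : 72 * B0 ^+ 2 * A * rho `^ (- h) <= n * rho.
  rewrite powRN ler_pdivrMr ?powR_gt0//.
  have -> : n * rho * rho `^ h = n * rho `^ (1 + h).
    by rewrite gt0_powRD// powRr1 ?(ltW rho0)// mulrA.
  apply: (@le_trans _ _ (n * (B0 `^ (1 + h) * eps `^ (1 + h)))); last first.
    rewrite -powRM ?(ltW B00) ?(ltW eps0)// ler_pM2l//.
    by apply: ge0_ler_powR; rewrite ?nnegrE ?(ltW rho0) ?(ltW Be0)//; lra.
  have -> : B0 ^+ 2 = B0 `^ 2 by rewrite powR_mulrn ?(ltW B00).
  have BB : B0 `^ 2 * B0 `^ (2 * h) = B0 `^ (1 + h) * B0 `^ (1 + h).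
    by rewrite -!gt0_powRD//; congr (_ `^ _); ring.
  rewrite [leRHS]mulrCA.
  apply: (@le_trans _ _ (B0 `^ (1 + h) * (K * a * B0 `^ (1 + h)))); last first.
    by rewrite ler_pM2l ?powR_gt0.
  have -> : 72 * B0 `^ 2 * A = 72 * CA * (a * (B0 `^ (1 + h) * B0 `^ (1 + h))).
    by rewrite /A -BB; ring.
  have -> : B0 `^ (1 + h) * (K * a * B0 `^ (1 + h)) =
     K * (a * (B0 `^ (1 + h) * B0 `^ (1 + h))) by ring.
  by rewrite ler_wpM2r// !mulr_ge0 ?powR_ge0// ltW.
have -> : 2 * (3 * B0) ^+ 2 * (2 * (A * rho `^ (- h)) + 4 * x) =
  (72 * B0 ^+ 2 * A * rho `^ (- h) + 144 * x * B0 ^+ 2) / 2 by field.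
by lra.
Qed.

(* Whichever of the variance [tau0] and of the product [B0 * eps] of range and
   deviation realizes the maximum, the corresponding pair of rates applies. *)
Lemma rate_chaining (a x n eps B0 tau0 h CA C r K W : R) :
  0 < a -> 0 < x -> 0 < n -> 0 < eps -> 0 < B0 -> 0 < tau0 -> 0 < h < 1 ->
  0 < CA -> 1 <= C -> 0 < r < 1 -> 0 < K ->
  K * a * (B0 `^ (2 * h) * tau0 `^ (1 - h)) <= n * eps ^+ 2 ->
  K * a * B0 `^ (1 + h) <= n * eps `^ (1 + h) ->
  K * x * tau0 <= n * eps ^+ 2 ->
  K * x * B0 <= n * eps ->
  (2048 * CA + 128) * C * 256 <= K * (1 - r) ^+ 2 ->
  W = C * Num.max tau0 (B0 * eps) ->
  32 * W * (64 * (a * CA * B0 `^ (2 * h)) * W `^ (- h) + 4 * x) <=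
    n * (eps / 2 * (1 - r) / 8) ^+ 2.
Proof.
move=> a0 x0 n0 eps0 B00 tau00 /andP[h0 h1] CA0 C1 /andP[r0 r1] K0 k1 k2 k3 k4 hK WE.
set A := a * CA * B0 `^ (2 * h); set M := Num.max tau0 (B0 * eps) in WE.
have A0 : 0 < A by rewrite !mulr_gt0// powR_gt0.
have C0 : 0 < C by exact: lt_le_trans C1.
have M0 : 0 < M by rewrite lt_max tau00.
have e1 : x * M <= n * eps ^+ 2 / K.
  rewrite ler_pdivlMr//; rewrite /M; have [_|_] := leP tau0 (B0 * eps).
    rewrite (_ : _ * K = K * x * B0 * eps); last by ring.
    by rewrite expr2 mulrA ler_pM2r.
  by rewrite (_ : _ * K = K * x * tau0); [|ring].
have e2 : A * M `^ (1 - h) <= CA * (n * eps ^+ 2 / K).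
  rewrite (_ : A * _ = CA * (a * (B0 `^ (2 * h) * M `^ (1 - h)))); last by rewrite /A; ring.
  rewrite ler_pM2l// ler_pdivlMr// /M; have [_|_] := leP tau0 (B0 * eps); last first.
    by rewrite (_ : _ * K = K * a * (B0 `^ (2 * h) * tau0 `^ (1 - h))); [|ring].
  rewrite powRM ?(ltW B00) ?(ltW eps0)//.
  have -> : a * (B0 `^ (2 * h) * (B0 `^ (1 - h) * eps `^ (1 - h))) * K =
     K * a * B0 `^ (1 + h) * eps `^ (1 - h).
    have -> : B0 `^ (1 + h) = B0 `^ (2 * h) * B0 `^ (1 - h).
      by rewrite -gt0_powRD//; congr (_ `^ _); ring.
    by ring.
  apply: (@le_trans _ _ (n * eps `^ (1 + h) * eps `^ (1 - h))).
    by rewrite ler_pM2r ?powR_gt0.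
  rewrite -mulrA -gt0_powRD// (_ : 1 + h + (1 - h) = 2); last by ring.
  by rewrite powR_mulrn ?(ltW eps0).
have W0 : 0 < W by rewrite WE mulr_gt0.
have -> : 32 * W * (64 * A * W `^ (- h) + 4 * x) =
    2048 * (A * (W * W `^ (- h))) + 128 * (W * x) by ring.
have -> : W * W `^ (- h) = W `^ (1 - h).
  by rewrite gt0_powRD// powRr1 ?(ltW W0).
have WM : W `^ (1 - h) <= C * M `^ (1 - h).
  rewrite WE; apply: powR_ge1_le_scale; [by []|exact: ltW|].
  by rewrite subr_ge0 (ltW h1) gerBl ltW.
set Y := n * eps ^+ 2 / K in e1 e2 *.
have Y0 : 0 < Y by rewrite divr_gt0// mulr_gt0// exprn_gt0.
have f1 : A * W `^ (1 - h) <= C * (CA * Y).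
  by apply: (le_trans (ler_wpM2l (ltW A0) WM)); rewrite mulrCA ler_pM2l.
have f2 : W * x <= C * Y.
  by rewrite WE -mulrA [M * x]mulrC ler_pM2l.
have -> : n * (eps / 2 * (1 - r) / 8) ^+ 2 = Y * (K * (1 - r) ^+ 2 / 256).
  by rewrite /Y; field; rewrite gt_eqF.
apply: (@le_trans _ _ (Y * ((2048 * CA + 128) * C))).
  rewrite (_ : Y * _ = 2048 * (C * (CA * Y)) + 128 * (C * Y)); last by ring.
  apply: lerD; (apply: ler_wpM2l; first exact: ler0n).
    exact: f1.
  exact: f2.
rewrite ler_pM2l//; have q0 : 0 < 256 :> R by rewrite ltr0n.
by rewrite (ler_pdivlMr _ _ q0).
Qed.

(** Each lower bound on [eps] is inverted and multiplied by a quantity built from [eps / lambda]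
    that cancels the power of [lambda]; the remaining exponent identities are checked on
    logarithms. *)
Lemma rates_of_pow_ext (a p alpha v theta K lambda eps x n : R) :
  0 < a -> 0 < p < 2 -> 1 <= alpha <= 2 -> 0 < theta <= 1 -> 0 <= v <= 2 ->
  0 < K -> 0 < lambda -> 0 < eps -> 1 <= x -> 0 < n ->
  (pow_ext (K * a / (lambda `^ ((2 * alpha * p + v * (2 - p)) / 4) * n))
           4 (8 - 2 * alpha * p - (v + 2 * theta) * (2 - p)) <= eps%:E)%E ->
  (pow_ext (K * a / (lambda `^ (alpha * (2 + p) / 4) * n))
           4 ((2 + p) * (2 - alpha)) <= eps%:E)%E ->
  (pow_ext (K * x / (lambda `^ (v / 2) * n)) 2 (4 - v - 2 * theta) <= eps%:E)%E ->
  (pow_ext (K * x / (lambda `^ (alpha / 2) * n)) 2 (2 - alpha) <= eps%:E)%E ->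
  let h := p / 2 in
  let B0 := (eps / lambda) `^ (alpha / 2) in
  let tau0 := (eps / lambda) `^ (v / 2) * eps `^ theta in
  [/\ K * a * (B0 `^ (2 * h) * tau0 `^ (1 - h)) <= n * eps ^+ 2,
      K * a * B0 `^ (1 + h) <= n * eps `^ (1 + h),
      K * x * tau0 <= n * eps ^+ 2 &
      K * x * B0 <= n * eps].
Proof.
move=> a0 /andP[p0 p2] /andP[al1 al2] /andP[th0 th1] /andP[v0 v2] K0 l0 e0 x1 n0.
have x0 : 0 < x by lra.
have step (C D u den num : R) : 0 < C -> 0 < num -> 0 <= den ->
    (pow_ext (C / (lambda `^ u * n)) num den <= eps%:E)%E ->
    0 <= D -> C * D <= n * (lambda `^ u * eps `^ (den / num) * D).
  move=> C0 num0 den0 hp D0.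
  have lu : 0 < lambda `^ u by rewrite powR_gt0.
  have := pow_ext_le _ num0 den0 e0 hp.
  rewrite divr_ge0 ?(ltW C0) ?mulr_ge0 ?(ltW lu) ?(ltW n0)// => /(_ isT).
  rewrite ler_pdivrMr ?mulr_gt0// => hC.
  rewrite (_ : n * _ = (eps `^ (den / num) * (lambda `^ u * n)) * D); last by ring.
  by rewrite ler_wpM2r.
move=> k1 k2 k3 k4 h B0 tau0.
have pE (z w : R) : 0 < z -> z `^ w = expR (w * ln z) by move=> z0; rewrite /powR gt_eqF.
have el0 : 0 < eps / lambda by rewrite divr_gt0.
have lnel : ln (eps / lambda) = ln eps - ln lambda by rewrite ln_div ?posrE.
have B00 : 0 < B0 by rewrite powR_gt0.
have tau00 : 0 < tau0 by rewrite mulr_gt0 ?powR_gt0.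
have lnB0 : ln B0 = alpha / 2 * (ln eps - ln lambda) by rewrite /B0 ln_powR lnel.
have lntau0 : ln tau0 = v / 2 * (ln eps - ln lambda) + theta * ln eps.
  by rewrite /tau0 lnM ?posrE ?powR_gt0// !ln_powR lnel.
have eX (m : nat) : eps ^+ m = expR (m%:R * ln eps).
  by rewrite -powR_mulrn ?(ltW e0)// pE.
have e1 : eps = expR (ln eps) by rewrite lnK ?posrE.
split.
- apply: le_trans (step _ _ _ _ _ _ _ _ k1 _) _.
  + by rewrite mulr_gt0.
  + by [].
  (* The denominator is at least [8 - 4 p - 4 (2 - p) = 0]. *)
  + by have := mulr_ge0 (_ : 0 <= 2 - alpha) (ltW p0); nra.
  + by rewrite mulr_ge0 ?powR_ge0.
  rewrite ler_pM2l// eX !pE// lnB0 lntau0 -!expRD ler_expR.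
  by rewrite le_eqVlt; apply/orP; left; apply/eqP; rewrite /h; field.
- apply: le_trans (step _ _ _ _ _ _ _ _ k2 _) _.
  + by rewrite mulr_gt0.
  + by [].
  + by rewrite mulr_ge0; lra.
  + by rewrite powR_ge0.
  rewrite ler_pM2l// !pE// lnB0 -!expRD ler_expR.
  by rewrite le_eqVlt; apply/orP; left; apply/eqP; rewrite /h; field.
- apply: le_trans (step _ _ _ _ _ _ _ _ k3 _) _.
  + by rewrite mulr_gt0.
  + by [].
  + by lra.
  + exact: ltW.
  rewrite ler_pM2l// eX -[tau0 in leLHS]lnK ?posrE// !pE// lntau0 -!expRD ler_expR.
  by rewrite le_eqVlt; apply/orP; left; apply/eqP; field.
- apply: le_trans (step _ _ _ _ _ _ _ _ k4 _) _.
  + by rewrite mulr_gt0.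
  + by [].
  + by lra.
  + exact: ltW.
  rewrite ler_pM2l// [in leRHS]e1 -[B0 in leLHS]lnK ?posrE// !pE// lnB0 -!expRD ler_expR.
  by rewrite le_eqVlt; apply/orP; left; apply/eqP; field.
Qed.

End Rates.

(** * The oracle inequality *)

Section CoveringNumber.
Context (R : realType) (X : Type) (H : set (X -> R)).
Variable ip : (X -> R) -> (X -> R) -> R.

(** An empty infimum is [+oo], so finiteness provides a cover, and a nonempty set of naturals
    attains its infimum. *)
Lemma covnum_attained (delta : R) (n : nat) (TX : 'I_n -> X) :
  covnum_BH H ip delta TX \is a fin_num ->
  exists m : nat, [/\ fine (covnum_BH H ip delta TX) = m%:R, (1 <= m)%N &
    exists c : 'I_m -> (X -> R), forall f, H f -> Hnorm ip f <= 1 ->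
      exists j : 'I_m, L2emp_norm TX (fun x => f x - c j x) <= delta].
Proof.
rewrite /covnum_BH; set S := [set m : nat | _] => hfin.
have Sex : exists m, `[< S m >].
  apply: contrapT => /forallNP hn.
  move: hfin; rewrite (_ : S = set0) ?image_set0 ?ereal_inf0//.
  by rewrite -subset0 => m Sm; apply: (hn m); apply/asboolP.
case: (ex_minnP Sex) => m /asboolP Sm hm; exists m.
split; [|exact: Sm.1|exact: Sm.2].
suff -> : ereal_inf [set (m%:R)%:E | m in S] = (m%:R)%:E :> \bar R by [].
apply/eqP; rewrite eq_le; apply/andP; split.
  by apply: ereal_inf_lbound; exists m.
apply: le_ereal_inf_tmp => _ [j Sj <-]; rewrite lee_fin ler_nat.
by apply: hm; apply/asboolP.
Qed.

(** Scaling by [1 / r] moves the class into the unit ball. The centers may lie outside [H], so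
    functions with the same center are compared through it, whence [2 r delta]. *)
Lemma entropy_of_cover (k : X -> X -> R) (hH : is_RKHS H ip k) (delta e r : R)
  (n : nat) (TX : 'I_n -> X) (I : finType) (fd : I -> X -> R) :
  (0 < n)%N -> 0 < delta -> 0 < r ->
  covnum_BH H ip delta TX \is a fin_num -> ln (fine (covnum_BH H ip delta TX)) <= e ->
  (forall i, H (fd i) /\ Hnorm ip (fd i) <= r) ->
  exists (N : nat) (code : I -> 'I_N), N%:R <= expR e /\
    forall i j, code i = code j ->
      \sum_l (fd i (TX l) - fd j (TX l)) ^+ 2 <= n%:R * (2 * r * delta) ^+ 2.
Proof.
move=> n0 d0 r0 /covnum_attained[N [-> N1 [c hc]]] hN hfd.
have n0R : 0 < n%:R :> R by rewrite ltr0n.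
have /choice[code hcode] : forall i, exists j : 'I_N,
    L2emp_norm TX (fun x => r^-1 * fd i x - c j x) <= delta.
  move=> i; have [Hf fr] := hfd i; apply: hc; first exact: (RKHS_scale hH).
  by rewrite (Hnorm_scale hH)// gtr0_norm ?invr_gt0// mulrC ler_pdivrMr// mul1r.
exists N, code; split.
  by rewrite -[N%:R]lnK ?posrE ?ltr0n// ler_expR.
have sq i : \sum_l (r^-1 * fd i (TX l) - c (code i) (TX l)) ^+ 2 <= n%:R * delta ^+ 2.
  have := hcode i; rewrite /L2emp_norm.
  set S := \sum_(l < n) _ => hS.
  have S0 : 0 <= n%:R^-1 * S.
    by rewrite mulr_ge0 ?invr_ge0 ?(ltW n0R)// sumr_ge0// => l _; exact: sqr_ge0.
  have : n%:R^-1 * S <= delta ^+ 2.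
    by rewrite -[leLHS]sqr_sqrtr// lerXn2r ?nnegrE ?sqrtr_ge0 ?(ltW d0).
  by rewrite mulrC ler_pdivrMr// mulrC.
move=> i j ij; have := sq i; have := sq j; rewrite ij => sj si.
have : \sum_l (fd i (TX l) - fd j (TX l)) ^+ 2 <=
    2 * r ^+ 2 * (\sum_l (r^-1 * fd i (TX l) - c (code j) (TX l)) ^+ 2) +
    2 * r ^+ 2 * (\sum_l (r^-1 * fd j (TX l) - c (code j) (TX l)) ^+ 2).
  rewrite !mulr_sumr -big_split; apply: ler_sum => l _ /=.
  move: (fd i (TX l)) (fd j (TX l)) (c (code j) (TX l)) => a b d.
  have -> : 2 * r ^+ 2 * (r^-1 * a - d) ^+ 2 + 2 * r ^+ 2 * (r^-1 * b - d) ^+ 2 =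
     2 * (a - r * d) ^+ 2 + 2 * (b - r * d) ^+ 2 by field; rewrite gt_eqF.
  by have := sqr_ge0 (a + b - 2 * r * d); nra.
move=> /le_trans; apply.
have r2 : 0 <= 2 * r ^+ 2 by rewrite mulr_ge0// sqr_ge0.
have := ler_wpM2l r2 si; have := ler_wpM2l r2 sj.
by lra.
Qed.

End CoveringNumber.

Lemma quadratic_continuous (R : realType) (a b c : R) :
  continuous (fun w : R => a * w ^+ 2 + b * w + c).
Proof.
move=> u; apply: cvgD; last exact: cvg_cst.
apply: cvgD; apply: cvgM; [exact: cvg_cst| |exact: cvg_cst|exact: cvg_id].
exact: exprn_continuous.
Qed.

(** [r^2] is the larger of 1/2 and [4^(h-1)], both below 1 because [h < 1]. *)
Lemma ratio_exists (R : realType) (h : R) : 0 < h < 1 ->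
  exists r : R, [/\ 0 < r < 1, 4 `^ h <= 4 * r ^+ 2 & 2 <= 4 * r ^+ 2].
Proof.
move=> /andP[h0 h1]; pose s := Num.max (1 / 2) (4 `^ (h - 1)).
have h4 : 4 `^ h = 4 * 4 `^ (h - 1) :> R.
  by rewrite -[X in X * _]powRr1// -gt0_powRD//; congr (_ `^ _); ring.
have s0 : 1 / 2 <= s by rewrite le_max lexx.
have s1 : s < 1.
  rewrite gt_max; apply/andP; split; first by lra.
  rewrite /powR gt_eqF// expR_lt1 nmulr_rlt0; last by lra.
  by apply: ln_gt0; lra.
have s2 : 4 `^ (h - 1) <= s by rewrite le_max lexx orbT.
exists (Num.sqrt s); rewrite sqr_sqrtr; last by lra.
split; [apply/andP; split|by rewrite h4; lra|by lra].
  by rewrite sqrtr_gt0; lra.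
by rewrite -sqrtr1 ltr_sqrt.
Qed.

(** In order: the entropy part of the second-moment condition; the range condition,
    [24 * 3 * 8 = 576]; the variance condition, with 64 from [(eps / 8)^2]; the chaining
    condition. *)
Definition large_constant (R : realType) (CA C c r K : R) : Prop :=
  [/\ 72 * CA <= K, 576 <= K, 96 * (72 * c) * 64 <= K &
      (2048 * CA + 128) * C * 256 <= K * (1 - r) ^+ 2].

Lemma large_constant_exists (R : realType) (CA C c r : R) : 0 < (1 - r) ^+ 2 ->
  exists K : R, 1 <= K /\ large_constant CA C c r K.
Proof.
move=> r0; suff [K [K1 hK]] : exists K : R, 1 <= K /\ forall u, u \in [:: 72 * CA; 576;
    96 * (72 * c) * 64; (2048 * CA + 128) * C * 256 / (1 - r) ^+ 2] -> u <= K.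
  by exists K; split=> //; split; rewrite -?ler_pdivrMr//; apply: hK;
    rewrite !inE eqxx ?orbT.
elim: [:: _; _; _; _] => [|w s [K [K1 hK]]]; first by exists 1.
exists (Num.max w K); split; first by rewrite le_max K1 orbT.
by move=> u; rewrite inE le_max => /predU1P[->|/hK ->]; rewrite ?lexx ?orbT.
Qed.

(** Deviations are run at level [4 x], which also exceeds 3. Since [exp (- x) <= 1/2], the surplus
    [exp (- 3 x) <= 1/8] absorbs the prefactor. *)
Lemma six_expR (R : realType) (x : R) : 1 <= x -> 6 * expR (- (4 * x)) <= expR (- x).
Proof.
move=> x1.
have -> : - (4 * x) = - x + - x * 3%:R by ring.
rewrite expRD expRM_natr mulrCA -[leRHS]mulr1 ler_wpM2l ?expR_ge0//.
have : 2 * expR (- x) <= 1.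
  rewrite expRN ler_pdivrMr ?expR_gt0// mul1r.
  by apply: le_trans (expR_ge1Dx _); lra.
have := expR_gt0 (- x); move: (expR (- x)) => z z0 z1.
have : (2 * z) ^+ 3 <= 1 by apply: exprn_ile1 => //; lra.
by rewrite exprMn; have : 0 < z ^+ 3 by [rewrite exprn_gt0]; lra.
Qed.

Section RiskFacts.
Context (R : realType) (X : pseudoPMetricType R).
Hypothesis X_compact : compact [set: X].
Variables (H : set (X -> R)) (ip : (X -> R) -> (X -> R) -> R) (k : X -> X -> R).
Hypothesis hH : is_RKHS H ip k.
Hypothesis k_cont : continuous (fun q : X * X => k q.1 q.2).
Hypothesis hsup : forall f, H f -> supnorm f <= Hnorm ip f.
Notation Z := (borelType (@open X) * R)%type.
Variable P : probability Z R.
Variables (L : R -> R -> R) (alpha cL : R).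
Hypothesis alpha12 : 1 <= alpha <= 2.
Hypothesis cL_gt0 : 0 < cL.
Hypothesis L_meas : forall f : borelType (@open X) -> R, measurable_fun setT f ->
  measurable_fun [set: Z] (fun z => L z.2 (f z.1)).
Hypothesis L_ge0 : forall y t, 0 <= L y t.
Hypothesis L_convex : forall y s t u : R, 0 <= u <= 1 ->
  L y (u * s + (1 - u) * t) <= u * L y s + (1 - u) * L y t.
Hypothesis L_growth : forall y t, L y t <= 1 + `|t| `^ alpha.
Hypothesis L_lip : forall t : R, 0 <= t -> forall y s1 s2, `|s1| <= t -> `|s2| <= t ->
  `|L y s1 - L y s2| <= cL * t `^ (alpha - 1) * `|s1 - s2|.

Lemma RKHS_measurable f : H f ->
  measurable_fun [set: borelType (@open X)] (f : borelType (@open X) -> R).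
Proof.
by move=> Hf; apply: continuous_borel_measurable; exact: (RKHS_continuous hH k_cont Hf).
Qed.

Lemma L_bound f y x r : H f -> Hnorm ip f <= r -> L y (f x) <= 1 + r `^ alpha.
Proof.
move=> Hf fr; have /andP[al1 _] := alpha12.
apply: (le_trans (L_growth _ _)); rewrite lerD2l.
have fx := RKHS_le_Hnorm X_compact hH k_cont hsup x Hf.
have r0 : 0 <= r by apply: le_trans fr; exact: Hnorm_ge0.
by apply: ge0_ler_powR; rewrite ?nnegrE//; lra.
Qed.

Definition real_risk (f : X -> R) : R := fine (risk P L f).

Lemma risk_ge0 f : (0 <= risk P L f)%E.
Proof. by apply: integral_ge0 => z _; rewrite lee_fin. Qed.

Lemma risk_integrable (f : borelType (@open X) -> R) : measurable_fun setT f ->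
  (risk P L f < +oo)%E ->
  P.-integrable [set: Z] (EFin \o (fun z => L z.2 (f z.1))).
Proof.
move=> mf ff; apply/integrableP; split; first by apply/measurable_EFinP; exact: L_meas.
by under eq_integral do rewrite /= ger0_norm//.
Qed.

Lemma risk_RKHS_lty f : H f -> (risk P L f < +oo)%E.
Proof.
move=> Hf; apply: (@le_lt_trans _ _ (\int[P]_z (1 + Hnorm ip f `^ alpha)%:E)%E).
  apply: ge0_le_integral => //.
  - by move=> z _; rewrite lee_fin.
  - by apply/measurable_EFinP; apply: L_meas; exact: RKHS_measurable.
  - by move=> z _; rewrite lee_fin; exact: L_bound.
by rewrite integral_cst// [X in (_ * X)%E]probability_setT mule1 ltry.
Qed.

Lemma riskE f : (risk P L f < +oo)%E -> risk P L f = (real_risk f)%:E.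
Proof. by move=> ff; rewrite /real_risk fineK// ge0_fin_numE// risk_ge0. Qed.

Lemma integral_loss_diff (f g : borelType (@open X) -> R) :
  measurable_fun setT f -> measurable_fun setT g ->
  (risk P L f < +oo)%E -> (risk P L g < +oo)%E ->
  (\int[P]_z (L z.2 (f z.1) - L z.2 (g z.1))%:E = (real_risk f - real_risk g)%:E)%E.
Proof.
move=> mf mg ff fg.
under eq_integral do rewrite EFinB.
rewrite (integralB measurableT (risk_integrable mf ff) (risk_integrable mg fg)).
by rewrite EFinB -!riskE.
Qed.

Lemma real_risk_lip f g r eta : H f -> H g -> 0 <= r ->
  (forall x, `|f x| <= r) -> (forall x, `|g x| <= r) ->
  (forall x, `|f x - g x| <= eta) ->
  `|real_risk f - real_risk g| <= cL * r `^ (alpha - 1) * eta.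
Proof.
move=> Hf Hg r0 fr gr fg.
have mf := RKHS_measurable Hf; have mg := RKHS_measurable Hg.
have ff := risk_RKHS_lty Hf; have gg := risk_RKHS_lty Hg.
rewrite -lee_fin -abse_EFin -integral_loss_diff//.
apply: le_trans (le_abse_integral _ _ _) _ => //.
  by apply/measurable_EFinP; apply: measurable_funB; exact: L_meas.
apply: (@le_trans _ _ (\int[P]_z (cL * r `^ (alpha - 1) * eta)%:E)%E).
  apply: ge0_le_integral => //.
  - apply: measurableT_comp => //; apply/measurable_EFinP.
    by apply: measurable_funB; exact: L_meas.
  - move=> z _; rewrite /= lee_fin.
    apply: (le_trans (L_lip r0 _ (fr _) (gr _))).
    by rewrite ler_wpM2l// mulr_ge0 ?powR_ge0// ltW.
by rewrite integral_cst// [X in (_ * X)%E]probability_setT mule1.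
Qed.

Definition mean_loss (n : nat) (T : 'I_n -> X * R) (f : X -> R) : R :=
  n%:R^-1 * \sum_(i < n) L (T i).2 (f (T i).1).

(* Convexity of the empirical functional along the segment from [fP] to [fT], and
   continuity of the true one, give a function at excess exactly [eps]. *)
Lemma localization (n : nat) (T : 'I_n -> X * R) (lambda eps : R) (fP fT : X -> R) :
  0 < lambda -> 0 < eps -> H fP -> H fT ->
  lambda * Hnorm ip fT ^+ 2 + mean_loss T fT <= lambda * Hnorm ip fP ^+ 2 + mean_loss T fP ->
  lambda * Hnorm ip fP ^+ 2 + real_risk fP + eps <= real_risk fT ->
  exists f, [/\ H f,
    lambda * Hnorm ip f ^+ 2 + real_risk f = lambda * Hnorm ip fP ^+ 2 + real_risk fP + eps &
    eps <= (real_risk f - mean_loss T f) - (real_risk fP - mean_loss T fP)].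
Proof.
move=> l0 e0 HP HT hT hbad.
pose fu u x := u * fT x + (1 - u) * fP x.
have Hu u : H (fu u) by exact: (RKHS_comb2 hH).
pose psi u := lambda * Hnorm ip (fu u) ^+ 2 + real_risk (fu u).
have fu0 : fu 0 = fP by apply/funext => x; rewrite /fu; ring.
have fu1 : fu 1 = fT by apply/funext => x; rewrite /fu; ring.
(* The norm part is quadratic in [u]; the risk part is Lipschitz near [u] because the functions
   [fu w] stay within the common bound [N] there. *)
have cpsi : continuous psi.
  move=> u; apply: cvgD.
    have E w : lambda * Hnorm ip (fu w) ^+ 2 =
        lambda * (ip fT fT - 2 * ip fT fP + ip fP fP) * w ^+ 2 +
        lambda * 2 * (ip fT fP - ip fP fP) * w + lambda * ip fP fP.
      by rewrite (Hnorm_sqr hH)// (ip_comb2 hH)//; ring.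
    rewrite E; under eq_fun do rewrite E.
    exact: quadratic_continuous.
  set S := Hnorm ip fT + Hnorm ip fP.
  have S0 : 0 <= S by rewrite addr_ge0 ?Hnorm_ge0.
  have fTS x : `|fT x| <= S.
    by have := RKHS_le_Hnorm X_compact hH k_cont hsup x HT;
      have := Hnorm_ge0 ip fP; rewrite /S; lra.
  have fPS x : `|fP x| <= S.
    by have := RKHS_le_Hnorm X_compact hH k_cont hsup x HP;
      have := Hnorm_ge0 ip fT; rewrite /S; lra.
  pose N := (2 * `|u| + 3) * S.
  have N0 : 0 <= N by rewrite mulr_ge0//; have := normr_ge0 u; lra.
  have bnd w x : `|w| <= `|u| + 1 -> `|fu w x| <= N.
    move=> wu; apply: (le_trans (ler_normD _ _)); rewrite !normrM.
    have : `|1 - w| <= 1 + `|w| by have := ler_normB 1 w; rewrite normr1.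
    have := normr_ge0 (1 - w); have := normr_ge0 w.
    have := fTS x; have := fPS x; have := normr_ge0 (fT x); have := normr_ge0 (fP x).
    rewrite /N; move: `|fT x| `|fP x| `|1 - w| `|w| `|u| wu => a b c d e; nra.
  pose C := cL * N `^ (alpha - 1) * (2 * S) + 1.
  have C0 : 0 < C.
    rewrite /C; have : 0 <= cL * N `^ (alpha - 1) * (2 * S); last by lra.
    by rewrite !mulr_ge0 ?powR_ge0 ?(ltW cL_gt0).
  apply/cvgrPdist_lt => e ee0.
  have [d d0 [d1 dC]] : exists2 d : R, 0 < d & d <= 1 /\ C * d <= e.
    exists (Num.min 1 (e / C)); first by rewrite lt_min ltr01 divr_gt0.
    split; first by rewrite ge_min lexx.
    by rewrite mulrC -ler_pdivlMr// ge_min lexx orbT.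
  near=> w.
  have wd : `|u - w| < d by near: w; apply/nbhs_ballP; exists d.
  have wu : `|w| <= `|u| + 1.
    have := ler_normB u (u - w); rewrite opprB addrC subrK; lra.
  have := @real_risk_lip (fu u) (fu w) N (2 * S * `|u - w|) (Hu u) (Hu w) N0.
  move=> /(_ _ _ _)/le_lt_trans -> //.
  - by move=> x; apply: bnd; lra.
  - by move=> x; exact: bnd.
  - move=> x; rewrite /fu (_ : _ - _ = (u - w) * (fT x - fP x)); last by ring.
    rewrite normrM mulrC ler_wpM2r//; apply: (le_trans (ler_normB _ _)).
    by have := fTS x; have := fPS x; lra.
  have : C * `|u - w| < e by apply: lt_le_trans dC; rewrite ltr_pM2l.
  by have := normr_ge0 (u - w); rewrite /C; lra.
have [u /andP[u0 u1] hu] : exists2 u, 0 <= u <= 1 & psi u = psi 0 + eps.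
  have := @IVT R psi 0 1 (psi 0 + eps) ler01 (continuous_subspaceT cpsi).
  have psi1 : psi 0 + eps <= psi 1.
    rewrite /psi fu0 fu1; apply: (le_trans hbad); rewrite lerDr mulr_ge0 ?(ltW l0)//.
    exact: sqr_ge0.
  rewrite min_l ?max_r; [|lra..].
  case=> [|u]; first by apply/andP; split; lra.
  by rewrite in_itv/= => u01 hu; exists u.
exists (fu u); split => //; first by rewrite -/(psi u) hu /psi fu0.
(* By convexity the empirical functional at [fu u] is at most that at [fP], while the true one is
   larger by [eps]; in the comparison the norm terms cancel. *)
have hemp : lambda * Hnorm ip (fu u) ^+ 2 + mean_loss T (fu u) <=
    lambda * Hnorm ip fP ^+ 2 + mean_loss T fP.
  have c1 : lambda * Hnorm ip (fu u) ^+ 2 <=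
     u * (lambda * Hnorm ip fT ^+ 2) + (1 - u) * (lambda * Hnorm ip fP ^+ 2).
    have := @Hnorm_sqr_convex _ _ _ _ _ hH u fT fP HT HP.
    rewrite u0 u1 => /(_ isT) /(ler_wpM2l (ltW l0)); lra.
  have c2 : mean_loss T (fu u) <= u * mean_loss T fT + (1 - u) * mean_loss T fP.
    rewrite /mean_loss mulrCA [X in _ + X]mulrCA -mulrDr ler_wpM2l ?invr_ge0//.
    rewrite !mulr_sumr -big_split; apply: ler_sum => i _ /=.
    by apply: L_convex; rewrite u0.
  have := ler_wpM2l u0 hT; lra.
by move: hu; rewrite /psi fu0; lra.
Unshelve. all: by end_near. Qed.

Variable fstar : X -> R.
Hypothesis fstar_meas :
  measurable_fun [set: borelType (@open X)] (fstar : borelType (@open X) -> R).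
Hypothesis fstar_bayes : risk P L fstar = bayes_risk P L.

Lemma risk_fstar_lty : (risk P L fstar < +oo)%E.
Proof.
have [[H0 _] _ _ _ _] := hH.
rewrite fstar_bayes; apply: le_lt_trans (risk_RKHS_lty H0).
by apply: ereal_inf_lbound; exists (fun=> 0) => //=; exact: RKHS_measurable.
Qed.

Lemma bayesE : bayes_risk P L = (real_risk fstar)%:E.
Proof. by rewrite -fstar_bayes riskE// risk_fstar_lty. Qed.

Lemma real_risk_fstar_le f : H f -> real_risk fstar <= real_risk f.
Proof.
move=> Hf; rewrite -lee_fin -bayesE -riskE ?risk_RKHS_lty//.
by apply: ereal_inf_lbound; exists f => //=; exact: RKHS_measurable.
Qed.

Variables (c theta v : R).
Hypothesis c_ge1 : 1 <= c.
Hypothesis theta01 : 0 < theta <= 1.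
Hypothesis v02 : 0 <= v <= 2.
Hypothesis hvar : forall lambda : R, 0 < lambda <= 1 -> forall f, H f ->
  Hnorm ip f <= lambda `^ (- (1 / 2)) ->
  (\int[P]_z (((L z.2 (f z.1) - L z.2 (fstar z.1)) ^+ 2)%R)%:E <=
   ((c * (supnorm f + 1) `^ v)%R)%:E *
   (\int[P]_z ((L z.2 (f z.1) - L z.2 (fstar z.1))%R)%:E) `^ theta)%E.

(** The variance hypothesis is used at [1 / (2 b)]. As [supnorm f + 1 <= 3 b^(1/2)] and [v <= 2],
    the first factor contributes 9; [(2 eps)^theta] contributes 2. *)
Lemma loss_variance f (b eps : R) : H f -> 1 <= b -> 0 < eps ->
  Hnorm ip f <= (2 * b) `^ (1 / 2) -> real_risk f - real_risk fstar <= 2 * eps ->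
  (\int[P]_z ((L z.2 (f z.1) - L z.2 (fstar z.1)) ^+ 2)%:E <=
    (18 * c * (b `^ (v / 2) * eps `^ theta))%:E)%E.
Proof.
move=> Hf b1 e0 fb fe.
have /andP[v0 v2] := v02; have /andP[t0 t1] := theta01; have c1 := c_ge1.
have b0 : 0 < b by lra.
have l01 : 0 < (2 * b)^-1 <= 1.
  rewrite invr_gt0 mulr_gt0//= invf_le1//; last by rewrite mulr_gt0.
  by lra.
have fb' : Hnorm ip f <= (2 * b)^-1 `^ (- (1 / 2)).
  apply: (le_trans fb); rewrite -[(2 * b)^-1]powR_inv1; last by lra.
  by rewrite -powRrM (_ : -1 * - (1 / 2) = 1 / 2); [|ring].
apply: (le_trans (hvar l01 Hf fb')).
rewrite integral_loss_diff//; [|exact: RKHS_measurable|exact: risk_RKHS_lty|exact: risk_fstar_lty].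
rewrite poweR_EFin -EFinM lee_fin.
have d0 : 0 <= real_risk f - real_risk fstar by rewrite subr_ge0 real_risk_fstar_le.
have s0 := supnorm_ge0 X_compact hH k_cont Hf.
have sb1 : 1 <= b `^ (1 / 2).
  have -> : (1 <= b `^ (1 / 2)) = (1 `^ (1 / 2) <= b `^ (1 / 2)) by rewrite powR1.
  by apply: ge0_ler_powR; rewrite ?nnegrE; lra.
have s3 : supnorm f + 1 <= 3 * b `^ (1 / 2).
  have : (2 * b) `^ (1 / 2) <= 2 * b `^ (1 / 2) by apply: powR_ge1_le_scale; lra.
  by have := hsup Hf; lra.
have p1 : (supnorm f + 1) `^ v <= 9 * b `^ (v / 2).
  apply: (@le_trans _ _ ((3 * b `^ (1 / 2)) `^ v)).
    by apply: ge0_ler_powR; rewrite ?nnegrE; lra.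
  rewrite powRM ?powR_ge0// -powRrM (_ : 1 / 2 * v = v / 2); last by ring.
  rewrite ler_wpM2r ?powR_ge0//.
  have -> : 9 = 3 `^ 2 :> R by rewrite powR_mulrn//; ring.
  by apply: ler_powR; lra.
have p2 : (real_risk f - real_risk fstar) `^ theta <= 2 * eps `^ theta.
  apply: (@le_trans _ _ ((2 * eps) `^ theta)).
    by apply: ge0_ler_powR; rewrite ?nnegrE; lra.
  by apply: powR_ge1_le_scale; lra.
rewrite (_ : 18 * c * _ = c * (9 * b `^ (v / 2)) * (2 * eps `^ theta)); last by ring.
by rewrite ler_pM ?mulr_ge0 ?powR_ge0 ?ler_wpM2l//; lra.
Qed.

(** Variances are known relative to [fstar], while the process is centered at a function of [H];
    going through [fstar] gives [72 = 2 * (18 + 18)]. *)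
Lemma loss_diff_variance f g (b eps : R) : H f -> H g -> 1 <= b -> 0 < eps ->
  Hnorm ip f <= (2 * b) `^ (1 / 2) -> real_risk f - real_risk fstar <= 2 * eps ->
  Hnorm ip g <= (2 * b) `^ (1 / 2) -> real_risk g - real_risk fstar <= 2 * eps ->
  (\int[P]_z ((L z.2 (f z.1) - L z.2 (g z.1)) ^+ 2)%:E <=
    (72 * c * (b `^ (v / 2) * eps `^ theta))%:E)%E.
Proof.
move=> Hf Hg b1 e0 fb fe gb ge.
have mL u : measurable_fun [set: borelType (@open X)] (u : borelType (@open X) -> R) ->
    measurable_fun [set: Z] (fun z : Z => (L z.2 (u z.1) - L z.2 (fstar z.1)) ^+ 2).
  by move=> mu; apply: measurable_funX; apply: measurable_funB; exact: L_meas.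
have mf := mL f (RKHS_measurable Hf); have mg := mL g (RKHS_measurable Hg).
have m2 (u : Z -> R) : measurable_fun setT u -> measurable_fun setT (fun z => 2 * u z).
  by move=> mu; apply: measurable_funM.
apply: (@le_trans _ _ (\int[P]_z (2 * (L z.2 (f z.1) - L z.2 (fstar z.1)) ^+ 2 +
    2 * (L z.2 (g z.1) - L z.2 (fstar z.1)) ^+ 2)%:E)%E).
  apply: ge0_le_integral => //.
  - by move=> z _; rewrite lee_fin sqr_ge0.
  - apply/measurable_EFinP; apply: measurable_funX.
    by apply: measurable_funB; apply: L_meas; exact: RKHS_measurable.
  - by apply/measurable_EFinP; apply: measurable_funD; exact: m2.
  - move=> z _; rewrite lee_fin.
    move: (L z.2 (f z.1)) (L z.2 (g z.1)) (L z.2 (fstar z.1)) => s t w.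
    by have := sqr_ge0 (s + t - 2 * w); nra.
under eq_integral do rewrite EFinD.
rewrite ge0_integralD//=; first last.
- by apply/measurable_EFinP; exact: m2.
- by move=> z _; rewrite lee_fin mulr_ge0// sqr_ge0.
- by apply/measurable_EFinP; exact: m2.
- by move=> z _; rewrite lee_fin mulr_ge0// sqr_ge0.
have Z2 (u : Z -> R) : measurable_fun setT u -> (forall z, 0 <= u z) ->
    (\int[P]_z (2 * u z)%:E = 2%:E * \int[P]_z (u z)%:E)%E.
  move=> mu u0; under eq_integral do rewrite EFinM.
  rewrite ge0_integralZl//; first exact/measurable_EFinP.
  by move=> z _; rewrite lee_fin.
rewrite !Z2//; [|by move=> z; exact: sqr_ge0..].
apply: (@le_trans _ _ (2%:E * (18 * c * (b `^ (v / 2) * eps `^ theta))%:E +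
    2%:E * (18 * c * (b `^ (v / 2) * eps `^ theta))%:E)%E).
  by apply: leeD; apply: lee_wpmul2l => //; exact: loss_variance.
by rewrite -EFinM -EFinD lee_fin; lra.
Qed.

Variables (a p : R).
Hypothesis a_ge1 : 1 <= a.
Hypothesis p02 : 0 < p < 2.
Hypothesis hcov : forall n : nat, (0 < n)%N -> forall delta : R, 0 < delta ->
  forall TX : 'I_n -> X, covnum_BH H ip delta TX \is a fin_num /\
    ln (fine (covnum_BH H ip delta TX)) <= a * delta `^ (- p).

Lemma loss_entropy (n : nat) (t : 'I_n -> Z) (I : finType) (fd : I -> X -> R) (b d : R) :
  (0 < n)%N -> 1 <= b -> (forall i, H (fd i) /\ Hnorm ip (fd i) <= (2 * b) `^ (1 / 2)) ->
  0 < d -> exists (N : nat) (code : I -> 'I_N),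
    N%:R <= expR (a * (4 * cL) `^ p * (b `^ (alpha / 2)) `^ (2 * (p / 2)) *
                  d `^ (- (p / 2))) /\
    forall i j, code i = code j ->
      \sum_l (L (t l).2 (fd i (t l).1) - L (t l).2 (fd j (t l).1)) ^+ 2 <= n%:R * d.
Proof.
move=> n0 b1 hfd d0.
have /andP[al1 al2] := alpha12; have cL0 := cL_gt0.
have b0 : 0 < b by lra.
have b20 : 0 < 2 * b by rewrite mulr_gt0.
set B0 := b `^ (alpha / 2); set r := (2 * b) `^ (1 / 2) in hfd *.
have B00 : 0 < B0 by rewrite powR_gt0.
have r0 : 0 < r by rewrite powR_gt0.
have ra : r `^ alpha <= 2 * B0.
  rewrite -powRrM (_ : 1 / 2 * alpha = alpha / 2); last by ring.
  by apply: powR_ge1_le_scale; lra.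
(* A cover at scale [delta] puts the losses within [2 cL r^alpha delta <= 4 cL B0 delta], and this
   choice makes the right side the square root of [d]. *)
pose delta := d `^ (1 / 2) / (4 * cL * B0).
have cB0 : 0 < 4 * cL * B0 by rewrite !mulr_gt0.
have delta0 : 0 < delta by rewrite divr_gt0// powR_gt0.
have [cfin cle] := hcov n0 delta0 (fun l => (t l).1).
have [N [code [hN hcode]]] := entropy_of_cover hH n0 delta0 r0 cfin cle hfd.
exists N, code; split.
  apply: (le_trans hN); rewrite ler_expR -!mulrA ler_pM2l; last by have := a_ge1; lra.
  have pE (z w : R) : 0 < z -> z `^ w = expR (w * ln z) by move=> z0; rewrite /powR gt_eqF.
  have c40 : 0 < 4 * cL by rewrite mulr_gt0.
  rewrite !pE// -!expRD ler_expR /delta ln_div ?posrE ?powR_gt0//.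
  rewrite (lnM (x := 4 * cL)) ?posrE// ln_powR.
  by rewrite le_eqVlt; apply/orP; left; apply/eqP; field.
move=> i j ij; have := hcode i j ij; set s := \sum_(l < n) _ => hs.
have ra1 : 0 <= cL * r `^ (alpha - 1) by rewrite mulr_ge0 ?powR_ge0// ltW.
apply: (@le_trans _ _ ((cL * r `^ (alpha - 1)) ^+ 2 * s)).
  rewrite mulr_sumr; apply: ler_sum => l _; rewrite -exprMn.
  have [Hi ri] := hfd i; have [Hj rj] := hfd j.
  rewrite -[leLHS]real_normK ?num_real// -[leRHS]real_normK ?num_real//.
  apply: lerXn2r; rewrite ?nnegrE// normrM [ `|cL * _|]ger0_norm//.
  apply: L_lip; first exact: ltW.
    exact: le_trans (RKHS_le_Hnorm X_compact hH k_cont hsup _ Hi) ri.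
  exact: le_trans (RKHS_le_Hnorm X_compact hH k_cont hsup _ Hj) rj.
apply: (le_trans (ler_wpM2l (sqr_ge0 _) hs)); rewrite mulrCA ler_wpM2l// -exprMn.
have -> : cL * r `^ (alpha - 1) * (2 * r * delta) = 2 * cL * (r `^ alpha * delta).
  have -> : r `^ alpha = r `^ (alpha - 1) * r.
    by rewrite -[X in _ * X]powRr1 ?(ltW r0)// -gt0_powRD// subrK.
  by ring.
have -> : d = (4 * cL * B0 * delta) ^+ 2.
  rewrite /delta mulrCA divff ?gt_eqF// mulr1 -powR_mulrn ?powR_ge0// -powRrM.
  by rewrite (_ : 1 / 2 * 2%:R = 1) ?powRr1 ?(ltW d0)//; field.
apply: lerXn2r; rewrite ?nnegrE ?mulr_ge0 ?powR_ge0 ?(ltW cL0) ?(ltW delta0)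
  ?(ltW B00) ?invr_ge0 ?(ltW cB0)//.
have := ler_wpM2l (mulr_ge0 (ltW cL0) (ltW delta0)) ra; lra.
Qed.

Lemma Hnorm_le_powR f (lambda e : R) : 0 < lambda -> 0 < e -> H f ->
  lambda * Hnorm ip f ^+ 2 <= 2 * e -> Hnorm ip f <= (2 * (e / lambda)) `^ (1 / 2).
Proof.
move=> l0 e0 Hf hf.
have -> : Hnorm ip f = (Hnorm ip f ^+ 2) `^ (1 / 2).
  rewrite -powR_mulrn ?Hnorm_ge0// -powRrM (_ : 2%:R * (1 / 2) = 1); last by field.
  by rewrite powRr1// Hnorm_ge0.
have el : 0 < e / lambda by rewrite divr_gt0.
have h2 : 0 <= 1 / 2 :> R by lra.
apply: (ge0_ler_powR h2); first by rewrite nnegrE sqr_ge0.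
  by rewrite nnegrE mulr_ge0// ltW.
by rewrite mulrA ler_pdivlMr// mulrC.
Qed.

Lemma loss_diff_bound f g z (b : R) : H f -> H g -> 1 <= b ->
  Hnorm ip f <= (2 * b) `^ (1 / 2) -> Hnorm ip g <= (2 * b) `^ (1 / 2) ->
  `|L z.2 (f z.1) - L z.2 (g z.1)| <= 3 * b `^ (alpha / 2).
Proof.
move=> Hf Hg b1 fb gb; have /andP[al1 al2] := alpha12.
have B1 : 1 <= b `^ (alpha / 2).
  have -> : (1 <= b `^ (alpha / 2)) = (1 `^ (alpha / 2) <= b `^ (alpha / 2)) by rewrite powR1.
  by apply: ge0_ler_powR; rewrite ?nnegrE; lra.
have ra : ((2 * b) `^ (1 / 2)) `^ alpha <= 2 * b `^ (alpha / 2).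
  rewrite -powRrM (_ : 1 / 2 * alpha = alpha / 2); last by ring.
  by apply: powR_ge1_le_scale; lra.
have := L_bound z.2 z.1 Hf fb; have := L_bound z.2 z.1 Hg gb.
have := L_ge0 z.2 (f z.1); have := L_ge0 z.2 (g z.1).
by rewrite ler_norml; lra.
Qed.

(** Replacing [f] by a net function moves the true and the empirical risk by one Lipschitz error
    each, hence the factor 2. *)
Lemma deviation_transfer (n : nat) (T : 'I_n -> X * R) (fP f f' : X -> R) (r eta : R) :
  (0 < n)%N -> 0 <= r -> H f -> H f' -> Hnorm ip f <= r -> Hnorm ip f' <= r ->
  (forall x, `|f x - f' x| <= eta) ->
  n%:R * ((real_risk f - mean_loss T f) - (real_risk fP - mean_loss T fP) -
    2 * (cL * r `^ (alpha - 1) * eta)) <=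
  \sum_l ((real_risk f' - real_risk fP) - (L (T l).2 (f' (T l).1) - L (T l).2 (fP (T l).1))).
Proof.
move=> n0 r0 Hf Hf' fr f'r ff'.
have n0R : 0 < n%:R :> R by rewrite ltr0n.
have fx x : `|f x| <= r.
  exact: le_trans (RKHS_le_Hnorm X_compact hH k_cont hsup _ Hf) fr.
have f'x x : `|f' x| <= r.
  exact: le_trans (RKHS_le_Hnorm X_compact hH k_cont hsup _ Hf') f'r.
set D := cL * r `^ (alpha - 1) * eta.
have := real_risk_lip Hf Hf' r0 fx f'x ff'; rewrite -/D ler_norml => /andP[_ h1].
have h2 : mean_loss T f' <= mean_loss T f + D.
  have -> : D = n%:R^-1 * \sum_(l < n) D.
    by rewrite sumr_const card_ord -[D *+ n]mulr_natl mulrA mulVf ?mul1r// gt_eqF.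
  rewrite /mean_loss -mulrDr ler_pM2l ?invr_gt0// -big_split; apply: ler_sum => l _ /=.
  have := L_lip r0 (T l).2 (fx (T l).1) (f'x (T l).1).
  rewrite ler_norml => /andP[h3 _].
  have := ler_wpM2l (mulr_ge0 (ltW cL_gt0) (powR_ge0 r (alpha - 1))) (ff' (T l).1).
  by rewrite -/D; lra.
have E u : \sum_(l < n) L (T l).2 (u (T l).1) = n%:R * mean_loss T u.
  by rewrite /mean_loss mulrA mulfV ?mul1r// gt_eqF.
rewrite [leRHS](_ : _ = n%:R * ((real_risk f' - real_risk fP) -
    (mean_loss T f' - mean_loss T fP))); last first.
  by rewrite sumrB sumr_const card_ord -[_ *+ n]mulr_natl sumrB !E -!mulrBr.
by rewrite ler_pM2l//; lra.
Qed.

Variable E : set Z.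
Hypothesis E_meas : measurable E.
Hypothesis PE : P E = 1%E.

Lemma oracle_inequality : exists K : R, 1 <= K /\
  forall (n : nat) (lambda eps x : R),
    (0 < n)%N -> 0 < lambda <= 1 -> 0 < eps -> 1 <= x ->
    forall fP : X -> R, is_reg_min H ip lambda (risk P L) fP ->
    forall fT : ('I_n -> X * R) -> (X -> R),
      (forall T : 'I_n -> Z, (forall i, E (T i)) ->
         is_reg_min H ip lambda (emp_risk L T) (fT T)) ->
    let aL := ((lambda * Hnorm ip fP ^+ 2)%:E + risk P L fP - bayes_risk P L)%E in
    (aL + lambda%:E <= eps%:E)%E ->
    (pow_ext (K * a / (lambda `^ ((2 * alpha * p + v * (2 - p)) / 4) * n%:R))
             4 (8 - 2 * alpha * p - (v + 2 * theta) * (2 - p)) <= eps%:E)%E ->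
    (pow_ext (K * a / (lambda `^ (alpha * (2 + p) / 4) * n%:R))
             4 ((2 + p) * (2 - alpha)) <= eps%:E)%E ->
    (pow_ext (K * x / (lambda `^ (v / 2) * n%:R))
             2 (4 - v - 2 * theta) <= eps%:E)%E ->
    (pow_ext (K * x / (lambda `^ (alpha / 2) * n%:R))
             2 (2 - alpha) <= eps%:E)%E ->
    ((1 - expR (- x))%:E <=
      outer_prob_n P [set T : 'I_n -> X * R | (forall i, E (T i)) /\
        (risk P L (fT T) - bayes_risk P L < aL + eps%:E)%E])%E.
Proof.
have /andP[al1 al2] := alpha12; have cL0 := cL_gt0; have c1 := c_ge1.
have a0 : 0 < a by have := a_ge1; lra.
have /andP[p0 p2] := p02.
pose h := p / 2.
have h01 : 0 < h < 1 by rewrite /h; lra.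
have [r [r01 rh r2]] := ratio_exists h01.
pose CA := (4 * cL) `^ p.
have CA0 : 0 < CA by rewrite powR_gt0 // mulr_gt0.
have c0 : 0 < c by lra.
(* [C1] makes [rho] at least 16 times the variance bound [72 c tau0]; [C] accounts for the diameter
   [256 rho] in chaining. *)
have [C1 C11 C1E] : exists2 C1 : R, 1 <= C1 & forall t, 16 * (72 * c * t) = C1 * t.
  by exists (16 * (72 * c)) => [|t]; [lra|ring].
have [C CC1 CE] : exists2 C : R, 1 <= C & forall t, 256 * (C1 * t) = C * t.
  by exists (256 * C1) => [|t]; [lra|ring].
have r0 : 0 < (1 - r) ^+ 2 by rewrite exprn_gt0//; lra.
have [K [K1 KP]] := large_constant_exists CA C c r0.
exists K; split=> // n lambda eps x n0 /andP[l0 l1] e0 x1 fP [HP minP] fT hfT.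
cbv zeta.
have n0R : 0 < n%:R :> R by rewrite ltr0n.
have K0 : 0 < K by exact: lt_le_trans K1.
have x0 : 0 < x by lra.
rewrite (riskE (risk_RKHS_lty HP)) bayesE -!EFinD !lee_fin => haL q1 q2 q3 q4.
have := rates_of_pow_ext a0 p02 alpha12 theta01 v02 K0 l0 e0 x1 n0R q1 q2 q3 q4.
cbv zeta; rewrite -/h; clear q1 q2 q3 q4.
set b := eps / lambda; set B0 := b `^ (alpha / 2).
set tau0 := b `^ (v / 2) * eps `^ theta => rates.
set NP := lambda * Hnorm ip fP ^+ 2 + real_risk fP in haL *.
have lN f : 0 <= lambda * Hnorm ip f ^+ 2 by rewrite mulr_ge0 ?sqr_ge0 ?(ltW l0).
have NPs : real_risk fstar <= NP by have := real_risk_fstar_le HP; have := lN fP; rewrite /NP; lra.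
have b1 : 1 <= b by rewrite /b ler_pdivlMr// mul1r; lra.
have b0 : 0 < b by lra.
have B00 : 0 < B0 by rewrite powR_gt0.
have tau00 : 0 < tau0 by rewrite mulr_gt0 ?powR_gt0.
pose rr := (2 * b) `^ (1 / 2).
have rr0 : 0 < rr by rewrite powR_gt0// mulr_gt0.
pose F : set (X -> R) := [set f | [/\ H f, Hnorm ip f <= rr &
    real_risk f - real_risk fstar <= 2 * eps]].
have FI f : H f -> lambda * Hnorm ip f ^+ 2 + real_risk f <= NP + eps -> F f.
  move=> Hf hf; have := real_risk_fstar_le Hf; have := lN f => ? ?; split=> //; last by lra.
  by apply: Hnorm_le_powR => //; lra.
have FP : F fP by apply: FI => //; rewrite -/NP; lra.
have [_ nP rP] := FP.
pose Cl := cL * rr `^ (alpha - 1).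
have Cl0 : 0 <= Cl by rewrite mulr_ge0 ?powR_ge0// ltW.
(* At this resolution passing to the net costs at most [2 Cl eta <= eps / 2], so deviations of size
   [eps / 2] remain to be excluded. *)
pose eta := eps / (4 * (Cl + 1)).
have eta0 : 0 < eta by rewrite divr_gt0// mulr_gt0// ltr_wpDl.
have Cleta : Cl * eta <= eps / 4.
  rewrite /eta (_ : Cl * _ = eps / 4 * (Cl / (Cl + 1))); last by field; rewrite gt_eqF// ltr_wpDl.
  apply: ler_piMr; first by rewrite divr_ge0 ?(ltW e0).
  by rewrite ler_pdivrMr ?mul1r ?lerDl//; exact: ltr_wpDl.
have [I [fd [hfd hnet]]] := RKHS_net X_compact hH k_cont hsup eta0 (ltW rr0) FP
  (fun f (hf : F f) => let: And3 Hf nf _ := hf in conj Hf nf).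
pose g i (z : Z) := L z.2 (fd i z.1) - L z.2 (fP z.1).
pose m i := real_risk (fd i) - real_risk fP.
pose rho := C1 * Num.max tau0 (B0 * eps).
have M1 : tau0 <= Num.max tau0 (B0 * eps) by rewrite le_max lexx.
have M2 : B0 * eps <= Num.max tau0 (B0 * eps) by rewrite le_max lexx orbT.
have M0 : 0 < Num.max tau0 (B0 * eps) by exact: lt_le_trans M1.
have Be0 : 0 < B0 * eps by rewrite mulr_gt0.
have Hfd i : H (fd i) by have [] := hfd i.
have key := @uniform_deviation_outer R X (@open X) P E n I g m
  (a * CA * B0 `^ (2 * h)) h (3 * B0) (72 * c * tau0) rho (4 * x) (eps / 2) r
  [set T : 'I_n -> X * R | (forall i, E (T i)) /\
        (risk P L (fT T) - (real_risk fstar)%:E < (NP - real_risk fstar + eps)%:E)%E] E_meas PE n0.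
apply: (@le_trans _ _ (1 - 6 * expR (- (4 * x)))%:E).
  by rewrite lee_fin lerD2l lerN2; exact: six_expR.
apply: (key _ _ _ _ _ h01 _ _ _ _ _ _ _ r01 rh r2 _ _ _ _) => {key}.
- by rewrite !mulr_ge0 ?powR_ge0 ?(ltW a0).
- by rewrite mulr_gt0.
- by rewrite mulr_gt0// mulr_gt0.
- by rewrite C1E ler_wpM2l// (le_trans ler01).
- by lra.
- by move=> i; apply: measurable_funB; apply: L_meas; apply: RKHS_measurable.
- by move=> i z; have [? ? _] := hfd i; apply: loss_diff_bound.
- move=> i; apply: integral_loss_diff.
  + exact: RKHS_measurable.
  + exact: RKHS_measurable.
  + exact: risk_RKHS_lty.
  + exact: risk_RKHS_lty.
- by move=> i; have [? ? ?] := hfd i; apply: loss_diff_variance.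
- move=> t d d0.
  have [N [code [hN hc]]] := @loss_entropy n t I fd b d n0 b1
     (fun i => let: And3 Hf nf _ := hfd i in conj Hf nf) d0.
  exists N, code; split; first exact: hN.
  move=> i j ij; apply: le_trans (hc i j ij).
  apply: ler_sum => l _; rewrite /g.
  by rewrite (_ : _ - _ - _ = L (t l).2 (fd i (t l).1) - L (t l).2 (fd j (t l).1)); [|ring].
- have [_ k2 _ k4] := rates.
  have [KCA K576 _ _] := KP; clear KP rates.
  apply: (rate_second_moment (eps := eps) (K := K)) => //; first by have /andP[] := h01.
  + by apply: (le_trans M2); rewrite ler_peMl ?(ltW M0).
  + by lra.
- by rewrite divr_gt0.
- rewrite (_ : n%:R * (eps / 2 / 4) ^+ 2 = n%:R * eps ^+ 2 / 64); last by field.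
  have [_ _ k3 _] := rates; rewrite ler_pdivlMr//; apply: le_trans k3.
  rewrite (_ : _ * 64 = 96 * (72 * c) * 64 * tau0); last by ring.
  have [_ _ KV _] := KP; rewrite ler_pM2r//; apply: (le_trans KV).
  by rewrite ler_peMr ?(ltW K0).
- rewrite (_ : n%:R * (eps / 2 / 4) = n%:R * eps / 8); last by field.
  have [_ _ _ k4] := rates; rewrite ler_pdivlMr//; apply: le_trans k4.
  rewrite (_ : _ * 8 = 576 * B0); last by ring.
  have [_ K576 _ _] := KP; rewrite ler_pM2r//; apply: (le_trans K576).
  by rewrite ler_peMr ?(ltW K0).
- have [k1 k2 k3 k4] := rates.
  have [_ _ _ KC] := KP; apply: (rate_chaining (tau0 := tau0) (eps := eps) (C := C) (K := K)) => //.
  exact: CE.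
- move=> t Et hdev; split => //; clear KP rates M1 M2 M0 Be0 B00 tau00.
  have [HT minT] := hfT t Et.
  rewrite (riskE (risk_RKHS_lty HT)) -EFinB lte_fin ltNge; apply/negP => bad.
  have hT : lambda * Hnorm ip (fT t) ^+ 2 + mean_loss t (fT t) <=
      lambda * Hnorm ip fP ^+ 2 + mean_loss t fP.
    by have := minT fP HP; rewrite /emp_risk -!EFinD lee_fin.
  have bad' : lambda * Hnorm ip fP ^+ 2 + real_risk fP + eps <= real_risk (fT t).
    by rewrite -/NP; lra.
  have [f [Hf hf1 hf2]] := localization l0 e0 HP HT hT bad'.
  have Ff : F f by apply: FI => //; rewrite hf1.
  have [i hi] := hnet f Ff; have [Hi ni _] := hfd i; have [_ nf _] := Ff.
  have := deviation_transfer t fP n0 (ltW rr0) Hf Hi nf ni hi.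
  rewrite -/Cl; apply/negP; rewrite -ltNge; apply: (lt_le_trans (hdev i)).
  by rewrite ler_pM2l//; lra.
Qed.

End RiskFacts.

(** * Labels outside Y *)

Section LossTruncation.
Context (R : realType) (X : pseudoPMetricType R) (Ys : set R) (L : R -> R -> R).
Hypothesis Ys_compact : compact Ys.
Hypothesis L_cont :
  {within Ys `*` [set: R], continuous (fun q : R * R => L q.1 q.2)}.

(* [L] is constrained only for labels in [Ys]; setting it to [0] elsewhere makes
   every hypothesis on it global without changing any integral against [P]. *)
Definition loss_on (y t : R) : R := if `[< Ys y >] then L y t else 0.

Lemma loss_onE y t : Ys y -> loss_on y t = L y t.
Proof. by move=> Yy; rewrite /loss_on asboolT. Qed.

Lemma loss_on_out y t : ~ Ys y -> loss_on y t = 0.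
Proof. by move=> Yy; rewrite /loss_on asboolF. Qed.

Lemma compact_measurable_real : measurable Ys.
Proof.
by apply: closed_measurable; apply: compact_closed Ys_compact; exact: Rhausdorff.
Qed.

(** Continuity of [L] within [Ys * R] yields both Caratheodory conditions: measurable sections in
    the label after restriction to [Ys], and continuity in the prediction, which is trivial off
    [Ys]. *)
Lemma loss_on_measurable (f : borelType (@open X) -> R) : measurable_fun setT f ->
  measurable_fun [set: borelType (@open X) * R] (fun z => loss_on z.2 (f z.1)).
Proof.
move=> mf; have mYs := compact_measurable_real.
have /subspace_continuousP hc := L_cont.
apply: (@measurable_fun_caratheodory _ _ R (fun z t => loss_on z.2 t) (f \o fst)).
- move=> t; apply: (measurableT_comp (f := fun y => loss_on y t)) => //.
  have -> : (fun y => loss_on y t) = (L ^~ t) \_ Ys.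
    apply/funext => y; rewrite patchE /loss_on.
    by case: asboolP => Yy; [rewrite mem_set|rewrite memNset].
  apply/(measurable_restrictT _ mYs).
  apply: subspace_continuous_measurable_fun => //.
  apply/subspace_continuousP => y Yy A hA.
  have [[U V] /= [Uy Vt] UV] := hc (y, t) (conj Yy Logic.I) A hA.
  apply: filterS Uy => y' Uy' Yy'.
  by apply: (UV (y', t)) => //; split => //=; exact: nbhs_singleton Vt.
- move=> z t; have [Yz|Yz] := pselect (Ys z.2); last first.
    rewrite /continuous_at /= loss_on_out//; under eq_fun do rewrite loss_on_out//.
    exact: cvg_cst.
  rewrite /continuous_at /= loss_onE//; under eq_fun do rewrite loss_onE//.
  move=> A hA.
  have [[U V] /= [Uy Vt] UV] := hc (z.2, t) (conj Yz Logic.I) A hA.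
  apply: filterS Vt => t' Vt'.
  by apply: (UV (z.2, t')) => //; split => //=; exact: nbhs_singleton Uy.
- exact: measurableT_comp.
Qed.

End LossTruncation.

Theorem theorem2p1 (R : realType) (X : pseudoPMetricType R)
  (* X is a compact metric space *)
  (hX_metric : hausdorff_space X) (hX_compact : compact [set: X])
  (* Y is a compact subset of [-1,1] *)
  (Ys : set R) (hY_compact : compact Ys)
  (hY_sub : forall y, Ys y -> -1 <= y <= 1)
  (* H is the RKHS of a continuous kernel k over X *)
  (H : set (X -> R)) (ip : (X -> R) -> (X -> R) -> R) (k : X -> X -> R)
  (hH : is_RKHS H ip k) (hk : continuous (fun q : X * X => k q.1 q.2))
  (hsup : forall f, H f -> supnorm f <= Hnorm ip f)
  (* entropy assumption *)
  (a p : R) (ha : 1 <= a) (hp : 0 < p < 2)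
  (hcov : forall n : nat, (0 < n)%N -> forall delta : R, 0 < delta ->
     forall T : 'I_n -> X * R, (forall i, Ys (T i).2) ->
       covnum_BH H ip delta (fun i => (T i).1) \is a fin_num /\
       ln (fine (covnum_BH H ip delta (fun i => (T i).1))) <= a * delta `^ (- p))
  (* the loss *)
  (L : R -> R -> R) (alpha cL : R) (halpha : 1 <= alpha <= 2) (hcL : 0 < cL)
  (hL_cont : {within Ys `*` [set: R], continuous (fun q : R * R => L q.1 q.2)})
  (hL_ge0 : forall y t, Ys y -> 0 <= L y t)
  (hL_convex : forall y, Ys y -> forall s t u : R, 0 <= u <= 1 ->
      L y (u * s + (1 - u) * t) <= u * L y s + (1 - u) * L y t)
  (hL_growth : forall y t, Ys y -> L y t <= 1 + `|t| `^ alpha)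
  (hL_lip : forall t : R, 0 <= t -> forall y s1 s2, Ys y -> `|s1| <= t -> `|s2| <= t ->
      `|L y s1 - L y s2| <= cL * t `^ (alpha - 1) * `|s1 - s2|)
  (* the distribution P on Z = X x Y (Borel probability on X x R concentrated on X x Y) *)
  (P : probability (borelType (@open X) * R)%type R)
  (hP : P ([set: borelType (@open X)] `*` Ys) = 1%E)
  (* a Bayes decision function f*_{L,P} *)
  (fstar : X -> R)
  (hfstar_meas : measurable_fun [set: borelType (@open X)] (fstar : borelType (@open X) -> R))
  (hfstar : risk P L fstar = bayes_risk P L)
  (* variance bound *)
  (c theta v : R) (hc : 1 <= c) (htheta : 0 < theta <= 1) (hv : 0 <= v <= 2)
  (hvar : forall lambda : R, 0 < lambda <= 1 -> forall f, H f ->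
      Hnorm ip f <= lambda `^ (- (1 / 2)) ->
      (\int[P]_z (((L z.2 (f z.1) - L z.2 (fstar z.1)) ^+ 2)%R)%:E <=
       ((c * (supnorm f + 1) `^ v)%R)%:E *
       (\int[P]_z ((L z.2 (f z.1) - L z.2 (fstar z.1))%R)%:E) `^ theta)%E) :
  exists K : R, 1 <= K /\
    forall (n : nat) (lambda eps x : R),
      (0 < n)%N -> 0 < lambda <= 1 -> 0 < eps -> 1 <= x ->
      (* f_{P,lambda} *)
      forall fP : X -> R, is_reg_min H ip lambda (risk P L) fP ->
      (* f_{T,lambda}, for every sample T in Z^n *)
      forall fT : ('I_n -> X * R) -> (X -> R),
        (forall T, (forall i, Ys (T i).2) ->
           is_reg_min H ip lambda (emp_risk L T) (fT T)) ->
      let aL := ((lambda * Hnorm ip fP ^+ 2)%:E + risk P L fP - bayes_risk P L)%E in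
      (aL + lambda%:E <= eps%:E)%E ->
      (pow_ext (K * a / (lambda `^ ((2 * alpha * p + v * (2 - p)) / 4) * n%:R))
               4 (8 - 2 * alpha * p - (v + 2 * theta) * (2 - p)) <= eps%:E)%E ->
      (pow_ext (K * a / (lambda `^ (alpha * (2 + p) / 4) * n%:R))
               4 ((2 + p) * (2 - alpha)) <= eps%:E)%E ->
      (pow_ext (K * x / (lambda `^ (v / 2) * n%:R))
               2 (4 - v - 2 * theta) <= eps%:E)%E ->
      (pow_ext (K * x / (lambda `^ (alpha / 2) * n%:R))
               2 (2 - alpha) <= eps%:E)%E ->
      ((1 - expR (- x))%:E <=
        outer_prob_n P [set T | (forall i, Ys (T i).2) /\
                          (risk P L (fT T) - bayes_risk P L < aL + eps%:E)%E])%E.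

Proof.
have mYs := compact_measurable_real hY_compact.
pose E : set (borelType (@open X) * R) := [set: borelType (@open X)] `*` Ys.
have mE : measurable E by exact: measurableX.
have PEc : P (~` E) = 0%E by rewrite probability_setC// hP subee.
(* [Ys] carries mass 1, hence is inhabited; [y0] later completes points of [X] to samples in [Z],
   over which [hcov] quantifies. *)
have [y0 Yy0] : exists y, Ys y.
  apply: contrapT => /forallNP hn.
  have : E = set0 by rewrite -subset0 => z [_ /hn].
  by move: hP; rewrite -/E => + E0; rewrite E0 measure0 => /eqP; rewrite eqe eq_sym oner_eq0.
pose Lt := loss_on Ys L.
have LtE y t : Ys y -> Lt y t = L y t by exact: loss_onE.
have intE (F G : borelType (@open X) * R -> \bar R) : (forall z, E z -> F z = G z) ->
    (\int[P]_z F z = \int[P]_z G z)%E.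
  by exact: integral_null_ext mE PEc.
have riskE' : risk P Lt = risk P L.
  by apply/funext => f; apply: intE => z [_ Yz]; rewrite LtE.
have bayesE' : bayes_risk P Lt = bayes_risk P L by rewrite /bayes_risk riskE'.
have [] := @oracle_inequality R X hX_compact H ip k hH hk hsup P Lt alpha cL halpha hcL
  _ _ _ _ _ fstar hfstar_meas _ c theta v hc htheta hv _ a p ha hp _ E mE hP.
- by move=> f mf; exact: loss_on_measurable.
- move=> y t; have [Yy|Yy] := pselect (Ys y); first by rewrite LtE// hL_ge0.
  by rewrite /Lt loss_on_out.
- move=> y s t u u01; have [Yy|Yy] := pselect (Ys y); first by rewrite !LtE// hL_convex.
  by rewrite /Lt !loss_on_out// !mulr0 addr0.
- move=> y t; have [Yy|Yy] := pselect (Ys y); first by rewrite LtE// hL_growth.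
  by rewrite /Lt loss_on_out// addr_ge0// powR_ge0.
- move=> t t0 y s1 s2 h1 h2; have [Yy|Yy] := pselect (Ys y).
    by rewrite !LtE//; exact: hL_lip.
  by rewrite /Lt !loss_on_out// subrr normr0 !mulr_ge0 ?powR_ge0// ltW.
- by rewrite riskE' bayesE'.
- move=> lambda l01 f Hf nf.
  rewrite (intE _ (fun z => ((L z.2 (f z.1) - L z.2 (fstar z.1)) ^+ 2)%:E)); last first.
    by move=> z [_ Yz]; rewrite !LtE.
  rewrite [X in (_ <= _ * X `^ _)%E](intE _ (fun z => (L z.2 (f z.1) - L z.2 (fstar z.1))%:E)).
    exact: hvar l01 f Hf nf.
  by move=> z [_ Yz]; rewrite !LtE.
- by move=> n n0 delta d0 TX; exact: (hcov n n0 delta d0 (fun i => (TX i, y0))).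
move=> K [K1 hK]; exists K; split=> // n lambda eps x n0 l01 e0 x1 fP hfP fT hfT.
have {}hK := hK n lambda eps x n0 l01 e0 x1 fP; rewrite riskE' bayesE' in hK.
have {}hK := hK hfP fT _; cbv zeta => h1 h2 h3 h4 h5.
have -> : [set T | (forall i, Ys (T i).2) /\ (risk P L (fT T) - bayes_risk P L <
     (lambda * Hnorm ip fP ^+ 2)%:E + risk P L fP - bayes_risk P L + eps%:E)%E] =
   [set T : 'I_n -> X * R | (forall i, E (T i)) /\ (risk P L (fT T) - bayes_risk P L <
     (lambda * Hnorm ip fP ^+ 2)%:E + risk P L fP - bayes_risk P L + eps%:E)%E].
  by apply/seteqP; split => T [hT hr]; split => // i; have [] := hT i.
apply: hK => // T ET.
have YT i : Ys (T i).2 by have [] := ET i.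
have -> : emp_risk Lt T = emp_risk L T; last exact: hfT.
by apply/funext => f; rewrite /emp_risk; under eq_bigr do rewrite LtE//.
Qed.
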